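(* Let $n\ge 2$, let $A_1,\dots,A_d\in\mathfrak{so}(n)$ ($d\ge 1$), and let $B_{i_1j_1},\dots,B_{i_ej_e}$ be elements of the standard basis $\{B_{ij}=E_{ij}-E_{ji}:1\le i<j\le n\}$ of $\mathfrak{so}(n)$. Let $\mathrm{G}_{\rm drift}$ be the undirected graph on $\mathrm{V}=\{1,\dots,n\}$ in which $\{i,j\}$ ($i\neq j$) is an edge iff $[A_s]_{ij}=-[A_s]_{ji}\neq 0$ for some $s\in\{1,\dots,d\}$, and let $\mathrm{G}_{\rm contr}$ be the undirected graph on $\mathrm{V}$ with edge set $\{\{i_1,j_1\},\dots,\{i_e,j_e\}\}$. If each connected component of $\mathrm{G}_{\rm contr}$ contains at least three nodes and the union graph $\mathrm{G}_{\rm drift}\cup\mathrm{G}_{\rm contr}$ (same node set, union of edge sets) is connected, then the system $$\dot X(t)=\mathsf B_0X(t)+\Big(\sum_{i=1}^m u_i(t)\mathsf B_i\Big)X(t),\qquad X(0)=X_0,$$ is structurally controllable on $\mathrm{SO}(n)$ with respect to the pair of zero patterns $\big(\Sigma_{\rm r}(\{A_1,\dots,A_d\}),\Sigma_{\rm f}(\{B_{i_1j_1},\dots,B_{i_ej_e}\})\big)$.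
   Context: $E_{ij}$ denotes the $n\times n$ matrix with $(i,j)$ entry $1$ and all other entries $0$. For a finite subset $\{g_1,\dots,g_k\}$ of a real Lie algebra $\mathfrak g$, the free zero pattern is $\Sigma_{\rm f}(\{g_1,\dots,g_k\})=\{\sum_s l_sg_s: l_s\in\mathbb R\}$ and the rigid zero pattern is $\Sigma_{\rm r}(\{g_1,\dots,g_k\})=\{\sum_s l_sg_s: l_s\in\mathbb R,\ l_s\neq 0 \text{ for all } s\}$. For a connected matrix Lie group $\mathbf G$ with Lie algebra $\mathfrak g$, consider $\dot X=\mathsf B_0X+(\sum_{i=1}^m u_i\mathsf B_i)X$ with $X(t)\in\mathbf G$, $\mathsf B_i\in\mathfrak g$, and piecewise continuous real controls $u_i$. The attainable set $\mathcal R(I)$ is the set of all $X(T)$, $T\ge 0$, over all such controls, starting from $X(0)=I$. The system is controllable if $\mathcal R(I)=\mathbf G$ and accessible if $\mathcal R(I)$ has an interior point in $\mathbf G$. The system is structurally controllable (resp. accessible) on $\mathbf G$ with respect to a pair $(\Sigma_{\rm r}(\mathfrak g_\alpha),\Sigma_{\rm f}(\mathfrak g_\beta))$ if there exist an integer $m\ge1$, $\mathsf B_0\in\Sigma_{\rm r}(\mathfrak g_\alpha)$ and $\mathsf B_1,\dots,\mathsf B_m\in\Sigma_{\rm f}(\mathfrak g_\beta)$ such that the resulting system is controllable (resp. accessible) on $\mathbf G$. *)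

(* Defs.v *)
From HB Require Import structures.
From mathcomp Require Import all_boot all_order all_algebra.
From mathcomp Require Import all_classical all_reals all_analysis.
Set Implicit Arguments. Unset Strict Implicit. Unset Printing Implicit Defensive.
Import Order.TTheory GRing.Theory Num.Theory.
Import numFieldNormedType.Exports.
Local Open Scope classical_set_scope.
Local Open Scope ring_scope.

Section Defs.
Variable R : realType.

Definition in_so (n : nat) (A : 'M[R]_n) : Prop := A^T = - A.

Definition in_SO (n : nat) (X : 'M[R]_n) : Prop := X *m X^T = 1%:M /\ \det X = 1.

Definition Bbasis (n : nat) (i j : 'I_n) : 'M[R]_n := delta_mx i j - delta_mx j i.

(* Zero patterns of the finite SET {g_1,...,g_k} given by a list (duplicates removed). *)
Definition free_pattern (n : nat) (gs : seq 'M[R]_n) : set 'M[R]_n :=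
  [set B | exists l : 'M[R]_n -> R, B = \sum_(g <- undup gs) l g *: g].
Definition rigid_pattern (n : nat) (gs : seq 'M[R]_n) : set 'M[R]_n :=
  [set B | exists l : 'M[R]_n -> R,
     (forall g, g \in gs -> l g != 0) /\ B = \sum_(g <- undup gs) l g *: g].

Definition piecewise_continuous (u : R -> R) (T : R) : Prop :=
  exists s : seq R,
    (forall t, 0 < t < T -> t \notin s -> u x @[x --> t] --> u t) /\
    (forall t, 0 <= t < T -> exists l : R, u x @[x --> t^'+] --> l) /\
    (forall t, 0 < t <= T -> exists l : R, u x @[x --> t^'-] --> l).

Definition is_trajectory (n m : nat) (B0 : 'M[R]_n) (Bs : 'I_m -> 'M[R]_n)
    (u : 'I_m -> R -> R) (T : R) (X : R -> 'M[R]_n) : Prop :=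
  X 0 = 1%:M /\
  (forall t, 0 <= t <= T -> in_SO (X t)) /\
  (forall i j, {within `[0, T], continuous (fun t => X t i j)}) /\
  exists s : seq R, forall t, 0 < t < T -> t \notin s ->
    forall i j, is_derive t 1 (fun t' => X t' i j)
                  (((B0 + \sum_(k < m) u k t *: Bs k) *m X t) i j).

Definition attainable (n m : nat) (B0 : 'M[R]_n) (Bs : 'I_m -> 'M[R]_n) : set 'M[R]_n :=
  [set Y | exists (T : R) (u : 'I_m -> R -> R) (X : R -> 'M[R]_n),
     0 <= T /\ (forall k, piecewise_continuous (u k) T) /\
     is_trajectory B0 Bs u T X /\ X T = Y].

Definition controllable_SO (n m : nat) (B0 : 'M[R]_n) (Bs : 'I_m -> 'M[R]_n) : Prop :=
  forall Y : 'M[R]_n, in_SO Y -> attainable B0 Bs Y.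

Definition structurally_controllable_SO (n : nat) (Aset Bset : seq 'M[R]_n) : Prop :=
  exists (m : nat) (B0 : 'M[R]_n) (Bs : 'I_m -> 'M[R]_n),
    (1 <= m)%N /\ rigid_pattern Aset B0 /\ (forall k, free_pattern Bset (Bs k)) /\
    controllable_SO B0 Bs.

Definition drift_rel (n : nat) (As : seq 'M[R]_n) : rel 'I_n :=
  fun i j => (i != j) && has (fun A : 'M[R]_n => A i j != 0) As.
Definition contr_rel (n : nat) (E : seq ('I_n * 'I_n)) : rel 'I_n :=
  fun i j => (i != j) && (((i, j) \in E) || ((j, i) \in E)).
Definition union_rel (T : Type) (e1 e2 : rel T) : rel T := fun i j => e1 i j || e2 i j.

Definition graph_connected (n : nat) (e : rel 'I_n) : Prop :=
  forall i j, connect e i j.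
Definition components_ge3 (n : nat) (e : rel 'I_n) : Prop :=
  forall i, (3 <= #|[set j | connect e i j]|)%N.

End Defs.

(* Main.v *)
Require Import Defs.
From HB Require Import structures.
From mathcomp Require Import all_boot all_order all_algebra.
From mathcomp Require Import all_classical all_reals all_analysis.
From mathcomp Require Import ring lra.
Set Implicit Arguments. Unset Strict Implicit. Unset Printing Implicit Defensive.
Import Order.TTheory GRing.Theory Num.Theory.
Import numFieldNormedType.Exports.
Local Open Scope classical_set_scope.
Local Open Scope ring_scope.

(* Choose the drift coefficients generically, so that [B0] is nonzero on every drift edge,
   and let [S] be the semigroup generated by the [mexp (B0 + sum u_k B_k) t], [0 <= t].

   Density.  Recurrence in the compact group [SO(n)] makes the closure of [S] a group, so
   (Trotter-Chernoff) the [A] with [exp (t A)] in the closure for all [t] form a subspace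
   stable under conjugation by the closure.  It contains [B0] and every [B0 + B_e], hence
   the [B_e], hence [B_ij] for [i, j] in one component of the control graph.  As these have
   at least three nodes, filtering [B0] with sign changes by rotations of angle [pi] isolates
   [B_ij] for each drift edge joining two components.  So all [B_ij] are obtained, and
   maximizing a weighted trace shows that the closure is [SO(n)].

   Exactness.  By density there is a product of exponentials in [S] whose logarithmic
   derivatives in the durations are close to all the [B_pq].  Minimizing the distance to a
   nearby target over a small box of durations gives an interior critical point, where the
   quotient is symmetric, orthogonal and close to 1, hence equal to 1.  So [S] contains an
   open set, and being dense it is all of [SO(n)]. *)

(** * Entrywise derivatives of matrix curves *)

Section MatrixDerivative.
Variables (R : realType) (n : nat).
Implicit Types (F G : R -> 'M[R]_n) (A B : 'M[R]_n) (t : R).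

Definition mderiv F t A :=
  forall i j, is_derive t 1 (fun s => F s i j) (A i j).

Lemma mderiv_eq F t A B : mderiv F t A -> A = B -> mderiv F t B.
Proof. by move=> h <-. Qed.

Lemma mderiv_ext F G t A : F =1 G -> mderiv F t A -> mderiv G t A.
Proof. by move=> /funext ->. Qed.

Lemma mderiv_cst A t : mderiv (fun=> A) t 0.
Proof. by move=> i j; rewrite mxE; exact: is_derive_cst. Qed.

Lemma mderivD F G t A B : mderiv F t A -> mderiv G t B ->
  mderiv (fun s => F s + G s) t (A + B).
Proof.
move=> hF hG i j; rewrite mxE.
rewrite (_ : (fun s => _) = (fun s => F s i j) + (fun s => G s i j)).
  exact: is_deriveD.
by apply/funext => s; rewrite mxE.
Qed.

Lemma mderivM F G t A B : mderiv F t A -> mderiv G t B ->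
  mderiv (fun s => F s *m G s) t (A *m G t + F t *m B).
Proof.
move=> hF hG i j; rewrite !mxE -big_split /=.
rewrite (_ : (fun s => _) =
    \sum_(k < n) ((fun s => F s i k) * (fun s => G s k j))).
  apply: is_derive_sum => k.
  apply: is_derive_eq (is_deriveM (hF i k) (hG k j)) _.
  by rewrite addrC; congr (_ + _); exact: mulrC.
by apply/funext => s; rewrite mxE fct_sumE.
Qed.

Lemma mderivZ (a : R -> R) (da : R) F t A : is_derive t 1 a da ->
  mderiv F t A -> mderiv (fun s => a s *: F s) t (da *: F t + a t *: A).
Proof.
move=> ha hF i j; rewrite !mxE.
rewrite (_ : (fun s => _) = a * (fun s => F s i j)); last first.
  by apply/funext => s; rewrite mxE.
apply: is_derive_eq (is_deriveM ha (hF i j)) _.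
by rewrite addrC; congr (_ + _); exact: mulrC.
Qed.

Lemma mderiv_tr F t A : mderiv F t A -> mderiv (fun s => (F s)^T) t A^T.
Proof.
move=> hF i j; rewrite mxE (_ : (fun s => _) = (fun s => F s j i)) //.
by apply/funext => s; rewrite mxE.
Qed.

Lemma mderiv_affine F t A (a b : R) : mderiv F (a + b * t) A ->
  mderiv (fun s => F (a + b * s)) t (b *: A).
Proof.
move=> hF i j; rewrite mxE mulrC.
have h : is_derive t 1 (fun s => a + b * s) b.
  rewrite (_ : (fun s => _) = cst a + b \*: id) //.
  have h1 := is_derive_cst a t 1.
  have h2 := is_deriveZ b (is_derive_id t 1).
  by apply: is_derive_eq (is_deriveD h1 h2) _; rewrite add0r; exact: mulr1.
exact: (@is_derive1_comp _ (fun s => F s i j) (fun s => a + b * s)).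
Qed.

Lemma mderiv_mulmxl F t A B : mderiv F t A ->
  mderiv (fun s => B *m F s) t (B *m A).
Proof.
move=> hF; apply: mderiv_eq; first exact: mderivM (mderiv_cst B t) hF.
by rewrite mul0mx add0r.
Qed.

Lemma mderiv_mulmxr F t A B : mderiv F t A ->
  mderiv (fun s => F s *m B) t (A *m B).
Proof.
move=> hF; apply: mderiv_eq; first exact: mderivM hF (mderiv_cst B t).
by rewrite mulmx0 addr0.
Qed.

Lemma mderiv0_cst F : (forall t, mderiv F t 0) -> forall s t, F s = F t.
Proof.
move=> hF s t; apply/matrixP => i j.
by apply: (is_derive_0_is_cst (f := fun s => F s i j)) => x; have := hF x i j; rewrite mxE.
Qed.

End MatrixDerivative.

(** * The matrix exponential and the linear equation that characterizes it *)

Section Exponential.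
Variables (R : realType) (n : nat).
Implicit Types (A B : 'M[R]_n) (t s : R).

(** Each entry is a scalar power series in [t], so that termwise differentiation of real power
    series applies. *)
Definition mexp A t : 'M[R]_n :=
  \matrix_(i, j) limn (pseries (fun k => (A ^+ k) i j / k`!%:R) t).

Definition mxsum A : R := \sum_i \sum_j `|A i j|.

Lemma mxsum_ge0 A : 0 <= mxsum A.
Proof. by apply: sumr_ge0 => i _; apply: sumr_ge0 => j _. Qed.

Lemma exprmx_bound A k i j : `|(A ^+ k) i j| <= mxsum A ^+ k.
Proof.
elim: k i j => [|k IH] i j.
  by rewrite !expr0 mxE; case: (i == j); rewrite ?normr1 ?normr0 ?ler01.
rewrite !exprS mxE; apply: le_trans (ler_norm_sum _ _ _) _.
apply: (@le_trans _ _ (\sum_l `|A i l| * mxsum A ^+ k)).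
  by apply: ler_sum => l _; rewrite normrM ler_wpM2l.
rewrite -mulr_suml ler_wpM2r ?exprn_ge0 ?mxsum_ge0 //.
rewrite /mxsum [leRHS](bigD1 i) //= lerDl.
by apply: sumr_ge0 => k' _; apply: sumr_ge0.
Qed.

(** The shift [m] covers the series of the derivatives. With [c := mxsum A], the entries of [A ^+ k]
    are at most [c ^+ k], so the series is dominated by [c ^+ m] times the exponential series of [c]
    times the absolute value of [t]. *)
Lemma mexp_cvg A m t i j :
  cvgn (pseries (fun k => (A ^+ (k + m)) i j / k`!%:R) t).
Proof.
apply: normed_cvg.
pose c := mxsum A.
apply: (@series_le_cvg _ _ (fun k => c ^+ m * exp_coeff (c * `|t|) k)).
- by move=> k /=; exact: normr_ge0.
- move=> k; rewrite mulr_ge0 ?exprn_ge0 ?mxsum_ge0 // /exp_coeff /=.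
  by rewrite divr_ge0 ?exprn_ge0 // mulr_ge0 // mxsum_ge0.
- move=> k /=; rewrite /exp_coeff /= !normrM normfV normr_nat normrX.
  rewrite exprMn mulrAC !mulrA ler_wpM2r ?invr_ge0 //.
  rewrite ler_wpM2r ?exprn_ge0 // -exprD [X in _ <= _ ^+ X]addnC.
  exact: exprmx_bound.
- have -> : series (fun k => c ^+ m * exp_coeff (c * `|t|) k) =
     (fun N => c ^+ m * series (exp_coeff (c * `|t|)) N).
    by apply/funext => N; rewrite /series /= mulr_sumr.
  apply: is_cvgM; first exact: is_cvg_cst.
  exact: is_cvg_series_exp_coeff.
Qed.

Lemma mexp_diffs A m i j :
  pseries_diffs (fun k => (A ^+ (k + m)) i j / k`!%:R) =
  (fun k => (A ^+ (k + m.+1)) i j / k`!%:R).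
Proof.
apply/funext => k; rewrite /pseries_diffs addSnnS factS natrM invfM.
by rewrite mulrCA mulVKf // pnatr_eq0.
Qed.

Lemma mderiv_mexp_series A t : mderiv (mexp A) t
  (\matrix_(i, j) limn (pseries (fun k => (A ^+ k.+1) i j / k`!%:R) t)).
Proof.
move=> i j; rewrite mxE.
have e0 : (fun s => mexp A s i j) =
    (fun s => limn (pseries (fun k => (A ^+ (k + 0)) i j / k`!%:R) s)).
  apply/funext => s; rewrite mxE; congr (limn (pseries _ s)).
  by apply/funext => k; rewrite addn0.
have e1 : (fun k => (A ^+ k.+1) i j / k`!%:R) =
    (fun k => (A ^+ (k + 1)) i j / k`!%:R).
  by apply/funext => k; rewrite addn1.
rewrite e0 e1 -mexp_diffs.
apply: (@pseries_snd_diffs _ _ (`|t| + 1)).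
- exact: mexp_cvg.
- by rewrite mexp_diffs; exact: mexp_cvg.
- by rewrite !mexp_diffs; exact: mexp_cvg.
- by rewrite [ltRHS]ger0_norm ?addr_ge0 // ltrDl.
Qed.

Lemma mexp_cvg_to A t i j :
  pseries (fun k => (A ^+ k) i j / k`!%:R) t @ \oo --> mexp A t i j.
Proof.
rewrite mxE.
rewrite (_ : (fun k => _) = (fun k => (A ^+ (k + 0)) i j / k`!%:R)).
  exact: mexp_cvg.
by apply/funext => k; rewrite addn0.
Qed.

(** One factor [A] is taken out of the partial sums, on the left here and on the right in
    [mderiv_mexpr]. *)
Lemma mderiv_mexp A t : mderiv (mexp A) t (A *m mexp A t).
Proof.
apply: mderiv_eq (mderiv_mexp_series A t) _; apply/matrixP => i j.
rewrite mxE [RHS]mxE; apply: cvg_lim => //.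
rewrite (_ : pseries _ t = fun N => \sum_l A i l *
    pseries (fun k => (A ^+ k) l j / k`!%:R) t N).
  apply: cvg_big => [|l _]; first exact: add_continuous.
  apply: cvgM; first exact: cvg_cst.
  exact: mexp_cvg_to.
apply/funext => N; rewrite /pseries /series /=.
under [RHS]eq_bigr do rewrite mulr_sumr.
rewrite exchange_big /=; apply: eq_bigr => k _.
rewrite exprS mxE !mulr_suml; apply: eq_bigr => l _.
by rewrite !mulrA.
Qed.

Lemma mderiv_mexpr A t : mderiv (mexp A) t (mexp A t *m A).
Proof.
apply: mderiv_eq (mderiv_mexp_series A t) _; apply/matrixP => i j.
rewrite mxE [RHS]mxE; apply: cvg_lim => //.
rewrite (_ : pseries _ t = fun N => \sum_l
    pseries (fun k => (A ^+ k) i l / k`!%:R) t N * A l j).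
  apply: cvg_big => [|l _]; first exact: add_continuous.
  apply: cvgM; last exact: cvg_cst.
  exact: mexp_cvg_to.
apply/funext => N; rewrite /pseries /series /=.
under [RHS]eq_bigr do rewrite mulr_suml.
rewrite exchange_big /=; apply: eq_bigr => k _.
rewrite exprSr mxE !mulr_suml; apply: eq_bigr => l _.
by rewrite -!mulrA; congr (_ * _); rewrite mulrC -!mulrA.
Qed.

Lemma mexp0 A : mexp A 0 = 1%:M.
Proof.
apply/matrixP => i j; rewrite !mxE; apply: cvg_lim => //.
rewrite -(cvg_shiftn 1) /=.
rewrite (_ : (fun N => _) = fun=> (i == j)%:R); first exact: cvg_cst.
apply/funext => N; rewrite /pseries /series /= addn1 big_nat_recl //= big1.
  by rewrite !mxE invr1 !mulr1 addr0.
by move=> k _; rewrite [0 ^+ _]exprS mul0r mulr0.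
Qed.

(* [mexp A (- t)] is the inverse of [mexp A t], so [F] is determined by
   differentiating [mexp A (- t) *m F t]. *)
Lemma ode_unique A F : (forall t, mderiv F t (A *m F t)) ->
  forall t, F t = mexp A t *m F 0.
Proof.
move=> hF t.
have inv s : mexp A s *m mexp A (- s) = 1%:M.
  have h u : mderiv (fun s => mexp A s *m mexp A (0 + -1 * s)) u 0.
    apply: mderiv_eq.
      apply: mderivM (mderiv_mexpr A u) _.
      apply: mderiv_affine; exact: mderiv_mexp.
    by rewrite -scalemxAr scaleN1r mulmxA subrr.
  have := mderiv0_cst h s 0; rewrite mulr0 addr0 !mexp0 mul1mx.
  by rewrite add0r mulN1r.
have h u : mderiv (fun s => mexp A (0 + -1 * s) *m F s) u 0.
  apply: mderiv_eq.
    apply: mderivM (hF u); apply: mderiv_affine; exact: mderiv_mexpr.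
  by rewrite -scalemxAl scaleN1r mulmxA addNr.
have := mderiv0_cst h t 0; rewrite mulr0 addr0 !mexp0 mul1mx add0r mulN1r => <-.
by rewrite mulmxA inv mul1mx.
Qed.

(** As functions of [s], both sides solve [F' = A F] with the same initial value. The rules below
    for scaling, conjugation and transposition use [ode_unique] in the same way. *)
Lemma mexpD A s t : mexp A (s + t) = mexp A s *m mexp A t.
Proof.
pose F u := mexp A (t + 1 * u).
have hF u : mderiv F u (A *m F u).
  apply: mderiv_eq; first by apply: mderiv_affine; exact: mderiv_mexp.
  by rewrite scale1r.
by have := ode_unique hF s; rewrite /F mulr0 mul1r addr0 addrC.
Qed.

Lemma mexpZ A c t : mexp (c *: A) t = mexp A (c * t).
Proof.
pose F u := mexp A (0 + c * u).
have hF u : mderiv F u ((c *: A) *m F u).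
  apply: mderiv_eq; first by apply: mderiv_affine; exact: mderiv_mexp.
  by rewrite -scalemxAl.
by have := ode_unique hF t; rewrite /F mulr0 addr0 mexp0 mulmx1 add0r.
Qed.

Lemma mexp_conj A P Q t : P *m Q = 1%:M -> Q *m P = 1%:M ->
  mexp (P *m A *m Q) t = P *m mexp A t *m Q.
Proof.
move=> PQ QP; pose F u := P *m mexp A u *m Q.
have hF u : mderiv F u ((P *m A *m Q) *m F u).
  apply: mderiv_eq.
    by apply: mderiv_mulmxr; apply: mderiv_mulmxl; exact: mderiv_mexp.
  by rewrite /F !mulmxA -[_ *m Q *m P]mulmxA QP mulmx1.
by have := ode_unique hF t; rewrite /F mexp0 mulmx1 PQ mulmx1.
Qed.

(** Right multiplication by [mexp A t] turns the commutator equation into [F' = A F]. *)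
Lemma mexp_commutator A (X : R -> 'M[R]_n) :
  (forall t, mderiv X t (A *m X t - X t *m A)) ->
  forall t, X t = mexp A t *m X 0 *m mexp A (- t).
Proof.
move=> hX t; pose F u := X u *m mexp A u.
have hF u : mderiv F u (A *m F u).
  apply: mderiv_eq; first exact: mderivM (hX u) (mderiv_mexp A u).
  by rewrite /F mulmxBl !mulmxA subrK.
have := ode_unique hF t; rewrite /F mexp0 mulmx1 => <-.
by rewrite -mulmxA -mexpD subrr mexp0 mulmx1.
Qed.

Lemma mexp_so A t : in_so A -> (mexp A t)^T = mexp A (- t).
Proof.
rewrite /in_so => hA; pose F u := (mexp A (0 + -1 * u))^T.
have hF u : mderiv F u (A *m F u).
  apply: mderiv_eq.
    by apply: mderiv_tr; apply: mderiv_affine; exact: mderiv_mexpr.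
  by rewrite scaleN1r linearN /= trmx_mul hA mulNmx opprK.
have := ode_unique hF (- t); rewrite /F mulr0 addr0 mexp0 trmx1 mulmx1.
by rewrite mulN1r opprK add0r.
Qed.

Lemma mexp_SO A t : in_so A -> in_SO (mexp A t).
Proof.
move=> hA; split.
  by rewrite mexp_so // -mexpD subrr mexp0.
(* Orthogonality only gives a determinant of square 1; the sign is settled because [mexp A t] is the
   square of [mexp A (t / 2)]. *)
have h s : \det (mexp A s) * \det (mexp A s) = 1.
  by rewrite -{2}det_tr -det_mulmx mexp_so // -mexpD subrr mexp0 det1.
by rewrite [t]splitr mexpD det_mulmx h.
Qed.

End Exponential.

(* Keeps unification from unfolding [mexp] down to limits of power series. *)
#[global] Opaque mexp.

(** * Entrywise estimates and the group SO(n) *)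

Section Orthogonal.
Variables (R : realType) (n : nat).
Implicit Types (A B P Q X Y : 'M[R]_n).

(** The closed ball of the entrywise maximum norm. This norm is submultiplicative only up to the
    factor [n], whence the powers of [n] in the later constants. *)
Definition small (e : R) A := forall i j, `|A i j| <= e.

Lemma small0 e : 0 <= e -> small e 0.
Proof. by move=> e0 i j; rewrite mxE normr0. Qed.

Lemma smallW e d A : e <= d -> small e A -> small d A.
Proof. by move=> ed hA i j; exact: le_trans ed. Qed.

Lemma smallD e d A B : small e A -> small d B -> small (e + d) (A + B).
Proof.
by move=> hA hB i j; rewrite mxE (le_trans (ler_normD _ _)) // lerD.
Qed.

Lemma smallN e A : small e A -> small e (- A).
Proof. by move=> hA i j; rewrite mxE normrN. Qed.

Lemma smallB e A B : small e (A - B) -> small e (B - A).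
Proof. by move=> /smallN; rewrite opprB. Qed.

Lemma small_tr e A : small e A -> small e A^T.
Proof. by move=> hA i j; rewrite mxE. Qed.

Lemma smallZ e c A : small e A -> small (`|c| * e) (c *: A).
Proof. by move=> hA i j; rewrite mxE normrM ler_wpM2l. Qed.

Lemma smallM e d A B : small e A -> small d B -> small (n%:R * (e * d)) (A *m B).
Proof.
move=> hA hB i j; rewrite mxE; apply: le_trans (ler_norm_sum _ _ _) _.
rewrite (@le_trans _ _ (\sum_(k < n) e * d)) //.
  by apply: ler_sum => k _; rewrite normrM ler_pM.
by rewrite sumr_const card_ord mulr_natl.
Qed.

Lemma small_mxsum A : small (mxsum A) A.
Proof.
move=> i j; rewrite /mxsum (bigD1 i) //= (bigD1 j) //= -addrA lerDl.
by rewrite addr_ge0 ?sumr_ge0 // => k _; rewrite sumr_ge0.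
Qed.

Lemma SO_trL X : in_SO X -> X^T *m X = 1%:M.
Proof. by case=> h _; exact: mulmx1C. Qed.

Lemma SO_trR X : in_SO X -> X *m X^T = 1%:M.
Proof. by case. Qed.

Lemma SO1 : in_SO (1%:M : 'M[R]_n).
Proof. by split; rewrite ?trmx1 ?mulmx1 ?det1. Qed.

Lemma SO_tr X : in_SO X -> in_SO X^T.
Proof. by move=> h; split; rewrite ?trmxK ?det_tr; [exact: SO_trL | case: h]. Qed.

Lemma SO_mul X Y : in_SO X -> in_SO Y -> in_SO (X *m Y).
Proof.
move=> [hX dX] [hY dY]; split; last by rewrite det_mulmx dX dY mulr1.
by rewrite trmx_mul mulmxA -[X *m Y *m _]mulmxA hY mulmx1.
Qed.

Lemma SO_exp X k : in_SO X -> in_SO (X ^+ k).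
Proof.
by move=> hX; elim: k => [|k IH]; [exact: SO1 | rewrite exprS; exact: SO_mul].
Qed.

(** The rows have Euclidean norm 1. *)
Lemma SO_small X : in_SO X -> small 1 X.
Proof.
move=> [/matrixP h _] i j; have := h i i.
rewrite !mxE eqxx (bigD1 j) //= mxE => h1.
have h2 : 0 <= \sum_(k < n | k != j) X i k * X^T k i.
  by apply: sumr_ge0 => k _; rewrite mxE -expr2 sqr_ge0.
have h3 : X i j ^+ 2 <= 1 ^+ 2 by rewrite expr1n expr2; lra.
by rewrite -(ler_pXn2r (n := 2)) ?nnegrE // -normrX (ger0_norm (sqr_ge0 _)).
Qed.

Lemma small_SOl e P X : in_SO P -> small e X -> small (n%:R * e) (P *m X).
Proof. by move=> /SO_small hP /(smallM hP); rewrite mul1r. Qed.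

Lemma small_SOr e P X : in_SO P -> small e X -> small (n%:R * e) (X *m P).
Proof. by move=> /SO_small hP hX; have := smallM hX hP; rewrite mulr1. Qed.

Lemma small_SO2 e P Q X : in_SO P -> in_SO Q -> small e X ->
  small (n%:R * (n%:R * e)) (P *m X *m Q).
Proof. by move=> hP hQ hX; apply: small_SOr => //; exact: small_SOl. Qed.

(* Multiplying by [S] throughout keeps the error linear in [k]: both outer factors
   of each telescoping term stay orthogonal. *)
Lemma small_expB e P Q S k : in_SO P -> in_SO Q -> in_SO S -> small e (P - Q) ->
  small (k%:R * (n%:R * (n%:R * e))) ((P ^+ k - Q ^+ k) *m S).
Proof.
move=> hP hQ + hPQ; elim: k S => [|k IH] S hS.
  by rewrite !expr0 subrr mul0mx mul0r; exact: small0.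
rewrite -natr1 mulrDl mul1r addrC.
have -> : (P ^+ k.+1 - Q ^+ k.+1) *m S =
    P ^+ k *m (P - Q) *m S + (P ^+ k - Q ^+ k) *m (Q *m S).
  rewrite !exprSr -!mulmxE mulmxBr mulmxA -mulmxDl; congr (_ *m _).
  by rewrite mulmxBl addrA subrK.
apply: smallD; last by apply: IH; exact: SO_mul.
by apply: small_SO2 => //; exact: SO_exp.
Qed.

(** The mean value theorem, one entry at a time. *)
Lemma mderiv_small_lip (F : R -> 'M[R]_n) (D : R -> 'M[R]_n) c :
  (forall t, mderiv F t (D t)) -> (forall t, small c (D t)) ->
  forall s t, small (c * `|t - s|) (F t - F s).
Proof.
move=> hF hD.
suff h s t : s <= t -> small (c * `|t - s|) (F t - F s).
  move=> s t; have [/h//|/ltW/h] := leP s t.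
  by rewrite distrC => /smallB.
move=> st i j; rewrite !mxE.
have cF : {within `[s, t], continuous (fun s => F s i j)}.
  apply/continuous_subspaceT => x.
  by apply/differentiable_continuous/derivable1_diffP; case: (hF x i j).
have dF x : x \in `]s, t[%R -> is_derive x 1 (fun s => F s i j) (D x i j).
  by move=> _; exact: hF.
have [x _ ->] := MVT_segment st dF cF.
by rewrite normrM ler_wpM2r //; exact: hD.
Qed.

Lemma mexp_lip A c s t : in_so A -> small c A ->
  small (n%:R * c * `|t - s|) (mexp A t - mexp A s).
Proof.
move=> hA hc; apply: mderiv_small_lip; first exact: mderiv_mexp.
by move=> u; apply: small_SOr => //; exact: mexp_SO.
Qed.

Lemma so_conj P A : in_so A -> in_so (P *m A *m P^T).
Proof. by rewrite /in_so !trmx_mul trmxK => ->; rewrite mulNmx mulmxN mulmxA. Qed.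

Lemma soD A B : in_so A -> in_so B -> in_so (A + B).
Proof. by rewrite /in_so linearD /= => -> ->; rewrite opprD. Qed.

Lemma soZ c A : in_so A -> in_so (c *: A).
Proof. by rewrite /in_so linearZ /= => ->; rewrite scalerN. Qed.

Lemma so_sum (I : Type) (r : seq I) (P : pred I) (F : I -> 'M[R]_n) :
  (forall i, P i -> in_so (F i)) -> in_so (\sum_(i <- r | P i) F i).
Proof.
move=> h; elim/big_ind: _ => //; last exact: soD.
by rewrite /in_so trmx0 oppr0.
Qed.

End Orthogonal.

(** * Plane rotations as exponentials of the [Bbasis i j] *)

Section Rotations.
Variables (R : realType) (n : nat).
Local Notation B := (@Bbasis R n).
Implicit Types (i j k : 'I_n).

Lemma Bbasis_so i j : in_so (B i j).
Proof. by rewrite /in_so /Bbasis linearB /= !trmx_delta opprB. Qed.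

Lemma BbasisC i j : B j i = - B i j.
Proof. by rewrite /Bbasis opprB. Qed.

Lemma Bbasis_sq i j : i != j -> B i j *m B i j = - (delta_mx i i + delta_mx j j).
Proof.
move=> ij; rewrite /Bbasis mulmxBl !mulmxBr !mul_delta_mx_cond.
by rewrite !eqxx (negPf ij) eq_sym (negPf ij) !mulr0n !mulr1n sub0r subr0 opprD.
Qed.

Lemma Bbasis_cube i j : i != j -> B i j *m B i j *m B i j = - B i j.
Proof.
move=> ij; rewrite Bbasis_sq // /Bbasis mulNmx mulmxDl !mulmxBr !mul_delta_mx_cond.
rewrite !eqxx (negPf ij) eq_sym (negPf ij) !mulr0n !mulr1n sub0r subr0.
by [].
Qed.

(** Rodrigues' formula: by the relation on [A], the span of 1, [A] and [A *m A] is stable under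
    multiplication by [A], and the right-hand side solves [F' = A F]. *)
Lemma mexp_cube (A : 'M[R]_n) t : A *m A *m A = - A ->
  mexp A t = 1%:M + sin t *: A + (1 - cos t) *: (A *m A).
Proof.
move=> A3; pose F t : 'M[R]_n := 1%:M + sin t *: A + (1 - cos t) *: (A *m A).
have hF u : mderiv F u (A *m F u).
  have h1 : is_derive u 1 (fun s => 1 - cos s) (sin u).
    have h := is_deriveB (is_derive_cst (1 : R) u 1) (is_derive_cos u).
    by apply: is_derive_eq h _; rewrite sub0r opprK.
  have h0 := mderiv_cst (1%:M : 'M[R]_n) u.
  have := mderivD (mderivD h0 (mderivZ (is_derive_sin u) (mderiv_cst A u)))
     (mderivZ h1 (mderiv_cst (A *m A) u)).
  move=> /mderiv_eq; apply.
  rewrite /F !mulmxDr mulmx1 -!scalemxAr mulmxA A3 !scaler0 !addr0 add0r.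
  by rewrite scalerN scalerBl scale1r opprB addrAC addrCA subrr addr0.
rewrite -[LHS]mulmx1; have := ode_unique hF t.
by rewrite {2}/F sin0 cos0 subrr !scale0r !addr0 => <-.
Qed.

Lemma mexp_Bbasis i j t : i != j ->
  mexp (B i j) t = 1%:M + sin t *: B i j + (1 - cos t) *: (B i j *m B i j).
Proof. by move=> ij; apply: mexp_cube; exact: Bbasis_cube. Qed.

(** The commutator with [C] acts on [A] and [D] as a quarter turn of a plane, so conjugation by
    [mexp C t] rotates that plane through the angle [t]. *)
Lemma mexp_conj_rot (A C D : 'M[R]_n) t :
  C *m A - A *m C = - D -> C *m D - D *m C = A ->
  mexp C t *m A *m mexp C (- t) = cos t *: A - sin t *: D.
Proof.
move=> hA hD; pose X t : 'M[R]_n := cos t *: A + (- sin t) *: D.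
have hX u : mderiv X u (C *m X u - X u *m C).
  have hs := is_deriveN (is_derive_sin u).
  have := mderivD (mderivZ (is_derive_cos u) (mderiv_cst A u))
     (mderivZ hs (mderiv_cst D u)).
  move=> /mderiv_eq; apply; rewrite !scaler0 !addr0 /X.
  rewrite mulmxDr mulmxDl -!scalemxAr -!scalemxAl.
  by rewrite opprD addrACA -!scalerBr hA hD !scaleNr scalerN addrC.
have := mexp_commutator hX t; rewrite {2}/X cos0 sin0 oppr0 scale0r scale1r addr0.
by move=> <-; rewrite /X scaleNr.
Qed.

Lemma mexp_Bbasis_conj i j k t : i != j -> j != k -> i != k ->
  mexp (B j k) t *m B i j *m mexp (B j k) (- t) = cos t *: B i j - sin t *: B i k.
Proof.
move=> ij jk ik.
have ji : j != i by rewrite eq_sym.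
have kj : k != j by rewrite eq_sym.
have ki : k != i by rewrite eq_sym.
apply: mexp_conj_rot; rewrite /Bbasis !mulmxBl !mulmxBr !mul_delta_mx_cond;
  rewrite !eqxx !(negPf ij, negPf jk, negPf ik, negPf ji, negPf kj, negPf ki);
  by rewrite !mulr0n !mulr1n !(subr0, sub0r, opprK, opprB, addr0, add0r) // addrC.
Qed.

End Rotations.

(** * Cluster points of bounded sequences *)

Section Compactness.
Variables (R : realType) (I : finType).

(** Tychonoff's theorem for the cube gives a cluster point in the product topology; as [I] is
    finite, closeness in all coordinates at once defines a neighbourhood of it. *)
Lemma bounded_cluster (x : nat -> I -> R) (M : R) :
  (forall k i, `|x k i| <= M) ->
  exists p : I -> R, forall e, 0 < e -> forall N, exists2 k, (N <= k)%N &
    forall i, `|p i - x k i| < e.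
Proof.
move=> hx.
have cK := @tychonoff I (fun=> R) (fun=> `[- M, M]%classic)
  (fun=> @segment_compact R _ _).
have [|p [_ pcl]] := cK (x @ \oo)%classic _.
  exists 0%N => // k _ i /=; rewrite in_itv /=; have := hx k i.
  by rewrite ler_norml.
exists p => e e0 N.
have h1 : (x @ \oo)%classic (x @` [set k | (N <= k)%N]).
  by exists N => // k Nk; exists k.
pose PT := prod_topology (fun _ : I => R).
have h2 : nbhs (p : PT) [set f | forall i, `|p i - f i| < e].
  have FF := @nbhs_filter PT p.
  apply: (@filter_forall _ I (fun i (f : PT) => `|p i - f i| < e) _ FF) => i.
  exact: (@proj_continuous I (fun=> R) i p _ (nbhsx_ballx (p i) e e0)).
have [_ [[k Nk <-] h]] := pcl _ _ h1 h2.
by exists k.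
Qed.

End Compactness.

Lemma small_factor (R : realFieldType) (c e : R) : 0 <= c -> 0 < e ->
  exists2 d, 0 < d & c * d <= e.
Proof.
(* Dividing by [c + 1] instead of [c] allows [c = 0]. *)
move=> c0 e0; exists (e / (c + 1)); first by rewrite divr_gt0 // ltr_wpDl.
rewrite mulrCA ger_pMr // ler_pdivrMr ?ltr_wpDl // mul1r lerDl.
exact: ler01.
Qed.

(** * The closure of a semigroup of rotations and its Lie algebra *)

Definition SO_semigroup (R : realType) (n : nat) (S : 'M[R]_n -> Prop) :=
  [/\ S 1%:M, forall X Y, S X -> S Y -> S (X *m Y) & forall X, S X -> in_SO X].

Section ClosedSemigroup.
Variables (R : realType) (n : nat) (S : 'M[R]_n -> Prop).
Hypothesis HS : SO_semigroup S.
Implicit Types (A B P X Y : 'M[R]_n).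

Let S1 : S 1%:M. Proof. by case: HS. Qed.
Let SM X Y : S X -> S Y -> S (X *m Y). Proof. by case: HS => _ h _; exact: h. Qed.
Let S_SO X : S X -> in_SO X. Proof. by case: HS => _ _; apply. Qed.

Definition clos X := forall e : R, 0 < e -> exists2 Y, S Y & small e (X - Y).

(** The entries of [X *m X^T] and the determinant are polynomials in the entries of [X], so they
    pass to the limit along a sequence in SO(n). *)
Lemma SO_closed X :
  (forall e : R, 0 < e -> exists2 Y, in_SO Y & small e (X - Y)) -> in_SO X.
Proof.
move=> hX.
have h k : exists Y, in_SO Y /\ small k.+1%:R^-1 (X - Y).
  by have [|Y] := hX k.+1%:R^-1; [rewrite invr_gt0 | exists Y].
have {h} [Y hY] := choice h.
have cv i j : Y k i j @[k --> \oo] --> X i j.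
  apply/cvgrPdist_le => e e0; near=> k.
  have := (hY k).2 i j; rewrite !mxE => /le_trans; apply.
  rewrite -[e]invrK lef_pV2 ?posrE ?invr_gt0 //.
  apply: (@le_trans _ _ k%:R); last by rewrite ler_nat.
  near: k; exact: nbhs_infty_ger.
split.
  apply/matrixP => i j.
  have h1 : (Y k *m (Y k)^T) i j @[k --> \oo] --> (X *m X^T) i j.
    rewrite mxE; under eq_cvg do rewrite mxE.
    apply: cvg_big => [|l _]; first exact: add_continuous.
    by rewrite mxE; under eq_cvg do rewrite mxE; exact: cvgM.
  rewrite -(cvg_lim (@Rhausdorff R) h1); apply: cvg_lim; first exact: Rhausdorff.
  under eq_cvg => k do rewrite (SO_trR (hY k).1).
  exact: cvg_cst.
have h1 : \det (Y k) @[k --> \oo] --> \det X.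
  apply: cvg_big => [|s _]; first exact: add_continuous.
  apply: cvgM; first exact: cvg_cst.
  by apply: cvg_big => [|l _]; [exact: mul_continuous | exact: cv].
rewrite -(cvg_lim (@Rhausdorff R) h1); apply: cvg_lim; first exact: Rhausdorff.
under eq_cvg => k do rewrite (hY k).1.2.
exact: cvg_cst.
Unshelve. all: by end_near. Qed.

Lemma clos_SO X : clos X -> in_SO X.
Proof.
move=> hX; apply: SO_closed => e /hX [Y /S_SO hY sY]; by exists Y.
Qed.

Lemma clos_sub X : S X -> clos X.
Proof. by move=> hX e /ltW e0; exists X => //; rewrite subrr; exact: small0. Qed.

Lemma clos_closed X :
  (forall e : R, 0 < e -> exists2 Y, clos Y & small e (X - Y)) -> clos X.
Proof.
move=> hX e e0; have e20 : 0 < e / 2 by rewrite divr_gt0.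
have [Y hY sY] := hX _ e20; have [Z hZ sZ] := hY _ e20.
exists Z => //; rewrite [e]splitr -(subrK Y X) -addrA.
exact: smallD.
Qed.

Lemma clos_mul X Y : clos X -> clos Y -> clos (X *m Y).
Proof.
move=> hX hY e e0.
have [d d0 hd] := small_factor (ler0n R (2 * n)) e0.
have [X' SX' sX] := hX _ d0; have [Y' SY' sY] := hY _ d0.
exists (X' *m Y'); first exact: SM.
have -> : X *m Y - X' *m Y' = X *m (Y - Y') + (X - X') *m Y'.
  by rewrite mulmxBr mulmxBl addrA subrK.
apply: smallW (smallD (small_SOl (clos_SO hX) sY) (small_SOr (S_SO SY') sX)).
by apply: le_trans hd; rewrite natrM; lra.
Qed.

Lemma clos1 : clos 1%:M.
Proof. exact: clos_sub. Qed.

Lemma clos_exp X k : clos X -> clos (X ^+ k).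
Proof.
by move=> hX; elim: k => [|k IH]; [exact: clos1 | rewrite exprS; exact: clos_mul].
Qed.

(* Recurrence: two powers of [X] are close, so some positive power is close to
   the inverse. *)
Lemma clos_tr X : clos X -> clos X^T.
Proof.
move=> hX; apply: clos_closed => e e0; have XSO := clos_SO hX.
have [|p hp] := @bounded_cluster R ('I_n * 'I_n)%type
    (fun k ij => (X ^+ k) ij.1 ij.2) 1.
  by move=> k [i j]; exact: (SO_small (SO_exp k XSO)).
have [d d0 hd] := small_factor (ler0n R (2 * n)) e0.
have [k _ hk] := hp _ d0 0%N; have [l kl hl] := hp _ d0 k.+1.
exists (X ^+ (l - k.+1)); first exact: clos_exp.
have hXX m : X ^+ m *m X^T ^+ m = 1%:M.
  elim: m => [|m IH]; first by rewrite !expr0 mulmx1.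
  by rewrite exprSr exprS -!mulmxE mulmxA -[_ *m X *m _]mulmxA (SO_trR XSO) mulmx1.
have -> : X^T - X ^+ (l - k.+1) = (X ^+ k - X ^+ l) *m X^T ^+ k.+1.
  rewrite mulmxBl exprSr -mulmxE mulmxA hXX mul1mx; congr (_ - _).
  by rewrite -[in RHS](subnK kl) exprD -mulmxE -mulmxA mulmxE -exprSr -mulmxE hXX mulmx1.
have sk : small (d + d) (X ^+ k - X ^+ l).
  move=> i j; rewrite !mxE.
  have -> : (X ^+ k) i j - (X ^+ l) i j =
     (p (i, j) - (X ^+ l) i j) - (p (i, j) - (X ^+ k) i j) by ring.
  apply: le_trans (ler_normB _ _) _; apply: lerD; apply/ltW.
    exact: (hl (i, j)).
  exact: (hk (i, j)).
apply: smallW (small_SOr (SO_exp _ (SO_tr XSO)) sk).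
by apply: le_trans hd; rewrite natrM; lra.
Qed.

(** This is [G h = o(h)]; the finitely many entries share one [d]. *)
Lemma mderiv0_small (G : R -> 'M[R]_n) : mderiv G 0 0 -> G 0 = 0 ->
  forall e, 0 < e -> exists2 d, 0 < d & forall h, `|h| < d -> small (e * `|h|) (G h).
Proof.
move=> hG G0 e e0.
have : \forall h \near (0 : R), forall ij : 'I_n * 'I_n,
    `|G h ij.1 ij.2| <= e * `|h|.
  apply: (@filter_forall R ('I_n * 'I_n)%type
    (fun ij h => `|G h ij.1 ij.2| <= e * `|h|) _ (nbhs_filter 0)) => -[i j] /=.
  have [dG vG] := hG i j; rewrite mxE in vG.
  have : (fun h => h^-1 *: (G (h *: 1 + 0) i j - G 0 i j)) @ 0^' -->
      'D_1 (fun s => G s i j) 0 by exact: dG.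
  rewrite vG.
  move/cvgrPdist_le => /(_ e e0); rewrite near_withinE => hn.
  near=> h.
  have [->|h0] := eqVneq h 0; first by rewrite G0 mxE !normr0 mulr0.
  have : h != 0 -> `|0 - h^-1 *: (G (h *: 1 + 0) i j - G 0 i j)| <= e.
    by near: h.
  move=> /(_ h0); rewrite sub0r normrN normrZ G0 mxE subr0 addr0 [h *: 1]mulr1.
  by rewrite normfV ler_pdivrMl ?normr_gt0 // mulrC.
rewrite -nbhs_nearE => /nbhs_ballP[d d0 hd]; exists d => // h hh i j.
by apply: (hd h _ (i, j)); rewrite /ball /= sub0r normrN.
Unshelve. all: by end_near. Qed.

(** Chernoff's product formula: [F (1 / k) ^+ k] tends to [mexp A 1]. At [1 / k] the two curves
    differ by [o(1 / k)], and by [small_expB] the [k]-th powers differ by at most [k * n ^ 2] times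
    as much. *)
Lemma clos_chernoff (F : R -> 'M[R]_n) A : in_so A -> (forall t, clos (F t)) ->
  F 0 = 1%:M -> mderiv F 0 A -> clos (mexp A 1).
Proof.
move=> soA hF F0 dF; apply: clos_closed => e e0.
pose G t : 'M[R]_n := F t + (- 1) *: mexp A t.
have dG : mderiv G 0 0.
  have h := mderivZ (is_derive_cst (-1 : R) (0 : R) (1 : R)) (mderiv_mexp A 0).
  apply: mderiv_eq (mderivD dF h) _.
  by rewrite scale0r add0r mexp0 mulmx1 scaleN1r subrr.
have G0 : G 0 = 0 by rewrite /G F0 mexp0 scaleN1r subrr.
have [d d0 hd] := small_factor (ler0n R (n * n)) e0.
have [r r0 hr] := mderiv0_small dG G0 d0.
have [k hk] : exists k : nat, k.+1%:R^-1 < r.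
  exists (Num.truncn r^-1); rewrite -[ltRHS]invrK ltf_pV2 ?posrE ?invr_gt0 //.
  by rewrite truncnS_gt.
have k0 : 0 < k.+1%:R^-1 :> R by rewrite invr_gt0.
exists (F k.+1%:R^-1 ^+ k.+1); first exact: clos_exp.
apply: smallB.
have -> : mexp A 1 = mexp A k.+1%:R^-1 ^+ k.+1.
  have h m : mexp A k.+1%:R^-1 ^+ m = mexp A (m%:R / k.+1%:R).
    elim: m => [|m IH]; first by rewrite expr0 mul0r mexp0.
    by rewrite exprS IH -mulmxE -mexpD -[m.+1]add1n natrD mulrDl mul1r.
  by rewrite h divff // pnatr_eq0.
have := hr k.+1%:R^-1; rewrite (gtr0_norm k0) => /(_ hk).
rewrite /G scaleN1r => sG.
have := small_expB k.+1 (clos_SO (hF _)) (mexp_SO _ soA) (SO1 _ _) sG.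
rewrite mulmx1; apply: smallW.
apply: le_trans hd; rewrite natrM -!mulrA.
by rewrite mulrCA ler_wpM2l // mulrCA ler_wpM2l // mulrCA divff ?mulr1 // pnatr_eq0.
Qed.

(** The Lie algebra of the closed group [clos S], described by one-parameter subgroups. *)
Definition lie A := in_so A /\ forall t, clos (mexp A t).

Lemma lie_pos A : in_so A -> (forall t, 0 <= t -> clos (mexp A t)) -> lie A.
Proof.
move=> soA hA; split=> // t; have [/hA//|t0] := leP 0 t.
by rewrite -[t]opprK -mexp_so //; apply: clos_tr; apply: hA; rewrite oppr_ge0 ltW.
Qed.

Lemma lieZ c A : lie A -> lie (c *: A).
Proof. by move=> [soA hA]; split; [exact: soZ | move=> t; rewrite mexpZ]. Qed.

(** Trotter's formula: the product of [mexp A (t * s)] and [mexp B (t * s)] stays in the closure and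
    has derivative [t *: (A + B)] at [s = 0]. *)
Lemma lieD A B : lie A -> lie B -> lie (A + B).
Proof.
move=> [soA hA] [soB hB]; split; first exact: soD.
move=> t; rewrite -[t]mulr1 -mexpZ.
apply: (@clos_chernoff (fun s => mexp A (0 + t * s) *m mexp B (0 + t * s))).
- exact/soZ/soD.
- by move=> s; exact: clos_mul.
- by rewrite mulr0 addr0 !mexp0 mulmx1.
- apply: mderiv_eq.
    by apply: mderivM; apply: mderiv_affine; exact: mderiv_mexp.
  by rewrite !(mulr0, addr0, mexp0, mulmx1) mul1mx scalerDr.
Qed.

Lemma lieB A B : lie A -> lie B -> lie (A - B).
Proof. by move=> hA hB; rewrite -scaleN1r; apply: lieD => //; exact: lieZ. Qed.

Lemma lie_conj P A : clos P -> lie A -> lie (P *m A *m P^T).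
Proof.
move=> hP [soA hA]; split; first exact: so_conj.
move=> t; have PSO := clos_SO hP.
rewrite mexp_conj; [| exact: SO_trR | exact: SO_trL].
by apply: clos_mul; [exact: clos_mul | exact: clos_tr].
Qed.

End ClosedSemigroup.

(** * Existence of maxima and the critical point condition *)

Section Maximum.
Variables (R : realType) (I : finType).

(** Points of [K] with values approaching the supremum have a cluster point, which is in [K] by
    closedness and attains the supremum by the Lipschitz bound. Functions on a finite type serve
    both for matrices and for tuples of durations. *)
Lemma bounded_closed_max (K : (I -> R) -> Prop) (f : (I -> R) -> R) (M C : R) x0 :
  (forall x, K x -> forall i, `|x i| <= M) ->
  (forall x, (forall e, 0 < e -> exists2 y, K y & forall i, `|x i - y i| < e) -> K x) ->
  0 <= M -> 0 <= C ->
  (forall x y e, 0 <= e -> K x -> K y -> (forall i, `|x i - y i| <= e) -> `|f x - f y| <= C * e) ->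
  K x0 -> exists2 x, K x & forall y, K y -> f y <= f x.
Proof.
move=> hM hcl M0 C0 hf Kx0.
pose E : set R := [set f x | x in K].
have supE : has_sup E.
  split; first by exists (f x0), x0.
  exists (f x0 + C * (M + M)) => _ [x Kx <-].
  rewrite -lerBlDl; apply: le_trans (ler_norm _) _; apply: hf => // [|i].
    by rewrite addr_ge0.
  by apply: le_trans (ler_normB _ _) _; apply: lerD; exact: hM.
have h k : exists x, K x /\ sup E - k.+1%:R^-1 < f x.
  have [|_ [x Kx <-] hx] := @sup_adherent R E k.+1%:R^-1 _ supE.
    by rewrite invr_gt0.
  by exists x.
have {h} [x hx] := choice h.
have [p hp] := bounded_cluster (fun k => hM _ (hx k).1).
have Kp : K p.
  apply: hcl => e e0; have [k _ hk] := hp e e0 0%N.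
  by exists (x k) => //; exact: (hx k).1.
exists p => // y Ky; apply: (@le_trans _ _ (sup E)).
  by apply: ub_le_sup; [case: supE | exists y].
apply/ler_addgt0Pr => e e0.
have e20 : 0 < e / 2 by rewrite divr_gt0.
have [d d0 hd] := small_factor C0 e20.
have [k hk hkp] := hp d d0 (Num.truncn (e / 2)^-1).
have h1 : sup E - k.+1%:R^-1 < f (x k) := (hx k).2.
have h2 : `|f p - f (x k)| <= C * d.
  by apply: hf; [exact: ltW | exact: Kp | exact: (hx k).1 | move=> i; exact: ltW].
have h3 : k.+1%:R^-1 <= e / 2.
  rewrite -[leRHS]invrK lef_pV2 ?posrE ?invr_gt0 //.
  by apply: ltW; apply: lt_le_trans (truncnS_gt _) _; rewrite ler_nat.
move: h2; rewrite ler_norml => /andP[h2 _].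
by move: h1 h3 h2 hd; set a := _^-1; lra.
Qed.

End Maximum.

Lemma derive_at_max (R : realType) (f df : R -> R) (c e : R) : 0 < e ->
  (forall t : R, is_derive t 1 f (df t)) ->
  (forall t, `|t - c| < e -> f t <= f c) -> df c = 0.
Proof.
move=> e0 hf hmax.
have [] := @derive1_at_max R f (c - e) (c + e) c.
- by rewrite lerD2l; lra.
- by move=> t _; case: (hf t).
- by rewrite in_itv /=; apply/andP; split; lra.
- by move=> t; rewrite in_itv /= => /andP[h1 h2]; apply: hmax; rewrite ltr_norml; lra.
- by move=> _ <-; case: (hf c).
Qed.

(** * All [Bbasis i j] are in the Lie algebra, and then the closure is SO(n) *)

Section Density.
Variables (R : realType) (n : nat) (S : 'M[R]_n -> Prop).
Hypothesis HS : SO_semigroup S.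
Local Notation B := (@Bbasis R n).
Local Notation lie := (lie S).
Local Notation clos := (clos S).
Implicit Types (A : 'M[R]_n) (i j k l p q : 'I_n).

Definition flip_sign k l p : R := if (p == k) || (p == l) then -1 else 1.

(** The rotation by [pi] in the [(k, l)] plane is diagonal, with -1 at [k] and [l] and 1
    elsewhere. *)
Lemma flip_conj A k l p q : k != l ->
  (mexp (B k l) pi *m A *m (mexp (B k l) pi)^T) p q =
  flip_sign k l p * flip_sign k l q * A p q.
Proof.
move=> kl; have -> : mexp (B k l) pi = diag_mx (\row_p flip_sign k l p).
  rewrite mexp_Bbasis // Bbasis_sq // sinpi cospi scale0r addr0 opprK.
  apply/matrixP => a b; rewrite !mxE /flip_sign.
  rewrite [b == k]eq_sym [b == l]eq_sym.
  have [<-|ab] := eqVneq a b.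
    rewrite [k == a]eq_sym [l == a]eq_sym !andbb.
    have [ak|_] := eqVneq a k; last by case: (a == l); rewrite /=; ring.
    by rewrite ak (negPf kl) /=; ring.
  have -> : (a == k) && (k == b) = false.
    by apply/negP => /andP[/eqP ak /eqP kb]; rewrite ak kb eqxx in ab.
  have -> : (a == l) && (l == b) = false.
    by apply/negP => /andP[/eqP ak /eqP kb]; rewrite ak kb eqxx in ab.
  by rewrite /=; ring.
rewrite tr_diag_mx mul_diag_mx mul_mx_diag !mxE.
by rewrite mulrAC.
Qed.

Lemma lie_flip A k l : k != l -> lie (B k l) -> lie A ->
  lie (mexp (B k l) pi *m A *m (mexp (B k l) pi)^T).
Proof. by move=> kl [_ hB] hA; apply: lie_conj. Qed.

(* [A - sAs] keeps the entries with exactly one index flipped by [s], and [A + sAs]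
   the others: only [(i, j)] and [(j, i)] survive the four filters. *)
Lemma lie_isolate A i i1 i2 j j1 j2 : uniq [:: i; i1; i2; j; j1; j2] ->
  lie A -> lie (B i i1) -> lie (B i1 i2) -> lie (B j j1) -> lie (B j1 j2) ->
  A i j != 0 -> lie (B i j).
Proof.
set L := [:: i; i1; i2; j; j1; j2] => uL hA hi hi1 hj hj1 Aij.
have idx (k : nat) x : (k < 6)%N -> (x == nth i L k) = (index x L == k).
  move=> k6; apply/eqP/eqP => [->|xk]; first exact: index_uniq.
  by rewrite -xk nth_index // -index_mem xk.
have neq (k l : nat) : (k < 6)%N -> (l < 6)%N -> k != l -> nth i L k != nth i L l.
  by move=> k6 l6 kl; rewrite nth_uniq.
have ii1 : i != i1 by exact: (neq 0%N 1%N isT isT isT).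
have i12 : i1 != i2 by exact: (neq 1%N 2%N isT isT isT).
have jj1 : j != j1 by exact: (neq 3%N 4%N isT isT isT).
have j12 : j1 != j2 by exact: (neq 4%N 5%N isT isT isT).
pose fl k l A := mexp (B k l) pi *m A *m (mexp (B k l) pi)^T.
pose A1 := A - fl i i1 A.
pose A2 := A1 - fl j j1 A1.
pose A3 := A2 + fl i1 i2 A2.
pose A4 := A3 + fl j1 j2 A3.
have l1 : lie A1 := lieB HS hA (lie_flip ii1 hi hA).
have l2 : lie A2 := lieB HS l1 (lie_flip jj1 hj l1).
have l3 : lie A3 := lieD HS l2 (lie_flip i12 hi1 l2).
have l4 : lie A4 := lieD HS l3 (lie_flip j12 hj1 l3).
have soA : forall p q, A q p = - A p q.
  by move=> p q; have /matrixP/(_ p q) := hA.1; rewrite !mxE.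
have flE k l X p q : k != l -> fl k l X p q = flip_sign k l p * flip_sign k l q * X p q.
  exact: flip_conj.
(* Each of the four filters doubles the surviving entries. *)
have e4 : A4 = (16%:R * A i j) *: B i j.
  apply/matrixP => p q.
  rewrite /A4 mxE flE // /A3 mxE flE // /A2 [(A1 - _) _ _]mxE [(- fl j j1 _) _ _]mxE flE //.
  rewrite /A1 ![(A - _) _ _]mxE ![(- fl i i1 _) _ _]mxE flE // !mxE /flip_sign.
  have Ei x : (x == i) = (index x L == 0%N) by exact: (idx 0%N x isT).
  have Ei1 x : (x == i1) = (index x L == 1%N) by exact: (idx 1%N x isT).
  have Ei2 x : (x == i2) = (index x L == 2%N) by exact: (idx 2%N x isT).
  have Ej x : (x == j) = (index x L == 3%N) by exact: (idx 3%N x isT).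
  have Ej1 x : (x == j1) = (index x L == 4%N) by exact: (idx 4%N x isT).
  have Ej2 x : (x == j2) = (index x L == 5%N) by exact: (idx 5%N x isT).
  have Aji : index p L = 3%N -> index q L = 0%N -> A p q = - A i j.
    move=> /eqP; rewrite -Ej => /eqP -> /eqP; rewrite -Ei => /eqP ->.
    exact: soA.
  have Apq : index p L = 0%N -> index q L = 3%N -> A p q = A i j.
    by move=> /eqP; rewrite -Ei => /eqP -> /eqP; rewrite -Ej => /eqP ->.
  rewrite !Ei !Ei1 !Ei2 !Ej !Ej1 !Ej2.
  have := index_size p L; have := index_size q L.
  move: Aji Apq; move: (index p L) (index q L) (A p q) => a b x.
  (* Only the positions in [L] matter now; position 6 stands for an index outside [L]. *)
  case: a => [|[|[|[|[|[|a]]]]]]; case: b => [|[|[|[|[|[|b]]]]]] /= Aji Apq _ _;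
    first [rewrite (Aji erefl erefl); ring | rewrite (Apq erefl erefl); ring | ring].
have nz : 16%:R * A i j != 0 by rewrite mulf_neq0 // pnatr_eq0.
by rewrite -[B i j]scale1r -(mulVf nz) -scalerA -e4; exact: lieZ.
Qed.

Lemma lie0 : lie 0.
Proof.
split=> [|t]; first by rewrite /in_so trmx0 oppr0.
have -> : (0 : 'M[R]_n) = 0 *: 0 by rewrite scale0r.
by rewrite mexpZ mul0r mexp0; exact: clos1.
Qed.

Lemma lie_Bbasis_refl i : lie (B i i).
Proof. by rewrite /Bbasis subrr; exact: lie0. Qed.

Lemma lie_Bbasis_sym i j : lie (B i j) -> lie (B j i).
Proof. by move=> h; rewrite BbasisC -scaleN1r; exact: lieZ. Qed.

(** A quarter turn in the [(j, k)] plane conjugates [B i j] into [B i k]. *)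
Lemma lie_Bbasis_trans i j k : lie (B i j) -> lie (B j k) -> lie (B i k).
Proof.
move=> hij hjk.
have [->//|ij] := eqVneq i j; have [<-//|jk] := eqVneq j k.
have [<-|ik] := eqVneq i k; first exact: lie_Bbasis_refl.
have := lie_conj HS (hjk.2 (- (pi / 2))) hij.
rewrite (mexp_so _ hjk.1) (mexp_Bbasis_conj _ ij jk ik).
by rewrite cosN sinN cos_pihalf sin_pihalf scale0r scaleN1r opprK add0r.
Qed.

Lemma lie_Bbasis_connect (e : rel 'I_n) :
  (forall i j, e i j -> lie (B i j)) -> forall i j, connect e i j -> lie (B i j).
Proof.
move=> he i j /connectP [p]; elim: p i => [|k p IH] i /=.
  by move=> _ ->; exact: lie_Bbasis_refl.
move=> /andP[eik ep] jl; exact: lie_Bbasis_trans (he _ _ eik) (IH k ep jl).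
Qed.

Lemma lie_all (e : rel 'I_n) A :
  lie A -> (forall i j, e i j -> lie (B i j)) ->
  components_ge3 e ->
  (forall i j, connect (union_rel (fun i j => A i j != 0) e) i j) ->
  forall i j, lie (B i j).
Proof.
move=> hA he h3 hc.
have hec := lie_Bbasis_connect he.
have h3' i : exists i1 i2, [/\ lie (B i i1), lie (B i i2) & uniq [:: i; i1; i2]].
  have : (1 < #|[predD1 connect e i & i]|)%N.
    have := h3 i; rewrite (@eq_card _ _ (connect e i)) => [|j].
      have ii : i \in connect e i by exact: connect0.
      by rewrite (cardD1 i) ii add1n ltnS.
    by apply/idP/idP => [/set_mem|h]; [exact | exact/mem_set].
  move=> /card_gt1P [x [y [+ + xy]]].
  rewrite !inE => /andP[xi /hec hx] /andP[yi /hec hy].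
  by exists x, y; split => //=; rewrite !inE negb_or ![i == _]eq_sym xi yi xy.
suff hu i j : union_rel (fun i j => A i j != 0) e i j -> lie (B i j).
  by move=> i j; exact: (lie_Bbasis_connect hu).
move=> /orP [Aij|]; last exact: he.
(* If [B i j] is missing, no node is linked to both [i] and [j], by transitivity. Three nodes around
   each of them are then the six distinct indices that [lie_isolate] needs. *)
have [//|nij] := pselect (lie (B i j)).
have [i1 [i2 [hi1 hi2 ui]]] := h3' i; have [j1 [j2 [hj1 hj2 uj]]] := h3' j.
have hi12 := lie_Bbasis_trans (lie_Bbasis_sym hi1) hi2.
have hj12 := lie_Bbasis_trans (lie_Bbasis_sym hj1) hj2.
apply: (lie_isolate _ hA hi1 hi12 hj1 hj12 Aij).
have -> : [:: i; i1; i2; j; j1; j2] = [:: i; i1; i2] ++ [:: j; j1; j2] by [].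
rewrite cat_uniq ui uj andbT andTb; apply/hasPn => y yj; apply/negP => yi.
apply: nij; apply: (@lie_Bbasis_trans _ y).
  move: yi; rewrite !inE => /or3P[/eqP ->|/eqP ->|/eqP ->];
    [exact: lie_Bbasis_refl | exact: hi1 | exact: hi2].
apply: lie_Bbasis_sym.
move: yj; rewrite !inE => /or3P[/eqP ->|/eqP ->|/eqP ->];
  [exact: lie_Bbasis_refl | exact: hj1 | exact: hj2].
Qed.

(** Positive and strictly decreasing: distinctness makes a matrix commuting with the squared weights
    diagonal, and the order fixes its signs. *)
Definition weight i : R := (n - i)%:R.

Lemma weight_gt0 i : 0 < weight i.
Proof. by rewrite ltr0n subn_gt0. Qed.

Lemma weight_lt i j : (i < j)%N -> weight j < weight i.
Proof. by move=> ij; rewrite ltr_nat ltn_sub2l. Qed.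

(** The first condition makes [Z *m D] symmetric, so [Z] commutes with [D *m D] and is diagonal with
    entries 1 or -1. The second excludes -1 except at the last index, where the determinant excludes
    it. *)
Lemma weight_max_id (Z : 'M[R]_n) : in_SO Z ->
  (forall i j, i != j -> weight i * Z j i = weight j * Z i j) ->
  (forall i j, i != j -> 0 <= weight i * Z i i + weight j * Z j j) -> Z = 1%:M.
Proof.
move=> ZSO hsym hpos.
pose D := diag_mx (\row_i weight i).
have tD : D^T = D by exact: tr_diag_mx.
have ZD : Z *m D = D *m Z^T.
  rewrite mul_diag_mx mul_mx_diag; apply/matrixP => i j; rewrite !mxE.
  have [->|ij] := eqVneq i j; first by rewrite mulrC.
  by rewrite (hsym _ _ ij) mulrC.
have comm : Z *m D *m D = D *m D *m Z.
  have h : D *m D = Z *m D *m D *m Z^T.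
    rewrite -[RHS]mulmxA -ZD {1}ZD -mulmxA [Z^T *m _]mulmxA (SO_trL ZSO).
    by rewrite mul1mx.
  by rewrite h -[RHS]mulmxA (SO_trL ZSO) mulmx1.
have Z0 i j : i != j -> Z i j = 0.
  move=> ij; have /matrixP/(_ i j) := comm.
  rewrite -[D *m D *m Z]mulmxA !mul_diag_mx !mul_mx_diag !mxE => h.
  have ne : weight i ^+ 2 != weight j ^+ 2.
    rewrite eqrXn2 ?ltW ?weight_gt0 //.
    move: ij; rewrite neq_ltn => /orP[/weight_lt h1|/weight_lt h1].
      by rewrite gt_eqF.
    by rewrite lt_eqF.
  have : (weight i ^+ 2 - weight j ^+ 2) * Z i j = 0 by rewrite !expr2; lra.
  by move/eqP; rewrite mulf_eq0 subr_eq0 (negPf ne) /= => /eqP.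
have Z1 i : Z i i ^+ 2 = 1.
  have /matrixP/(_ i i) := SO_trR ZSO.
  rewrite !mxE (bigD1 i) //= big1 ?addr0 => [|k ki].
    by rewrite mxE eqxx expr2.
  by rewrite Z0 ?mul0r // eq_sym.
have Zlt i j : (i < j)%N -> Z i i = 1.
  move=> ij; have := hpos i j; rewrite neq_ltn ij => /(_ isT).
  have := weight_lt ij; have := weight_gt0 i; have := weight_gt0 j.
  have /eqP := Z1 i; have /eqP := Z1 j; rewrite !sqrf_eq1.
  by move=> /orP[/eqP -> | /eqP ->] /orP[/eqP -> | /eqP ->]; lra.
have Zd i : Z i i = 1.
  have [[j ij]|nj] := pselect (exists j, (i < j)%N); first exact: Zlt ij.
  have Zo k : k != i -> Z k k = 1.
    move=> ki; apply: (@Zlt k i); rewrite ltn_neqAle ki /= leqNgt.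
    by apply/negP => ik; apply: nj; exists k.
  have := ZSO.2.
  have -> : Z = diag_mx (\row_k Z k k).
    apply/matrixP => a b; rewrite !mxE.
    by have [->|ab] := eqVneq a b; rewrite ?mulr1n // Z0 // mulr0n.
  rewrite det_diag (bigD1 i) //= big1 => [|k ki]; last by rewrite mxE Zo.
  by rewrite !mxE mulr1 eqxx mulr1n.
apply/matrixP => i j; rewrite mxE.
by have [->|/Z0] := eqVneq i j; [rewrite Zd mulr1n|].
Qed.

Lemma weight_delta (Z : 'M[R]_n) i j :
  \sum_a weight a * (delta_mx i j *m Z) a a = weight i * Z j i.
Proof.
have E a b : (delta_mx i j *m Z) a b = (a == i)%:R * Z j b.
  rewrite mxE (bigD1 j) //= big1 ?addr0 => [|k kj]; rewrite mxE.
    by rewrite eqxx andbT.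
  by rewrite (negPf kj) andbF mul0r.
rewrite (bigD1 i) //= big1 ?addr0 => [|k ki]; rewrite E.
  by rewrite eqxx mul1r.
by rewrite (negPf ki) mul0r mulr0.
Qed.

Lemma weight_rot (Z : 'M[R]_n) i j t : i != j ->
  \sum_a weight a * (mexp (B i j) t *m Z) a a =
  \sum_a weight a * Z a a + sin t * (weight i * Z j i - weight j * Z i j) -
  (1 - cos t) * (weight i * Z i i + weight j * Z j j).
Proof.
move=> ij; rewrite -!weight_delta mexp_Bbasis // Bbasis_sq // /Bbasis.
rewrite -sumrB -big_split /= !mulr_sumr -big_split -sumrB /=.
apply: eq_bigr => a _; rewrite !mulmxDl mul1mx -!scalemxAl mulNmx mulmxBl mulmxDl.
by rewrite !mxE; ring.
Qed.

(** Let [g] in the closure maximize the weighted trace of [g *m Y], where [Y] is the transposed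
    target. Multiplying [g] by [mexp (B i j) t] cannot increase it, which gives the conditions of
    [weight_max_id] for [Z := g *m Y]: symmetry from the derivative at [t = 0], positivity from
    [t = pi]. *)
Lemma clos_full : (forall i j, lie (B i j)) -> forall Y, in_SO Y -> clos Y.
Proof.
move=> hB Y0 Y0SO; pose Y := Y0^T.
have YSO : in_SO Y by exact: SO_tr.
pose f (g : 'M[R]_n) := \sum_i weight i * (g *m Y) i i.
pose mx (x : 'I_n * 'I_n -> R) : 'M[R]_n := \matrix_(i, j) x (i, j).
have mxK (g : 'M[R]_n) : mx (fun ij => g ij.1 ij.2) = g by apply/matrixP => i j; rewrite mxE.
have flip (g h : 'M[R]_n) e : small e (g - h) -> `|f g - f h| <= (\sum_i weight i * n%:R) * e.
  move=> s; rewrite /f -sumrB mulr_suml; apply: le_trans (ler_norm_sum _ _ _) _.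
  apply: ler_sum => i _; rewrite -mulrBr normrM (gtr0_norm (weight_gt0 i)).
  rewrite -mulrA (ler_wpM2l (ltW (weight_gt0 i))) //.
  have -> : (g *m Y) i i - (h *m Y) i i = ((g - h) *m Y) i i by rewrite mulmxBl !mxE.
  exact: (small_SOr YSO s).
have [||||||x Kx hx] := @bounded_closed_max R ('I_n * 'I_n)%type
  (fun x => clos (mx x)) (fun x => f (mx x)) 1 (\sum_i weight i * n%:R)
  (fun ij => (1%:M : 'M[R]_n) ij.1 ij.2)
  _ _ _ _ _ _.
- by move=> x Kx [i j]; have := SO_small (clos_SO HS Kx) i j; rewrite mxE.
- move=> x hx; apply: clos_closed => e /hx [y Ky hy].
  by exists (mx y) => // i j; rewrite !mxE ltW //; exact: (hy (i, j)).
- exact: ler01.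
- by apply: sumr_ge0 => i _; rewrite mulr_ge0 // ltW ?weight_gt0.
- by move=> x y e _ _ _ h; apply: flip => i j; rewrite !mxE; exact: (h (i, j)).
- by rewrite mxK; exact: clos1.
- set g := mx x in Kx hx; pose Z := g *m Y.
  have gSO : in_SO g by exact: (clos_SO HS Kx).
  have hmax i j t : i != j ->
      sin t * (weight i * Z j i - weight j * Z i j) -
      (1 - cos t) * (weight i * Z i i + weight j * Z j j) <= 0.
    move=> ij.
    have := hx (fun ab => (mexp (B i j) t *m g) ab.1 ab.2).
    rewrite mxK => /(_ (clos_mul HS ((hB i j).2 t) Kx)).
    by rewrite /f -mulmxA weight_rot // -addrA gerDl.
  have ZSO : in_SO Z by exact: SO_mul.
  have Z1 : Z = 1%:M.
    apply: weight_max_id => // i j ij; last first.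
      by have := hmax i j pi ij; rewrite sinpi cospi; lra.
    have := fun t => hmax i j t ij.
    set u := weight i * Z j i - weight j * Z i j.
    set v := weight i * Z i i + weight j * Z j j => hm.
    pose F (t : R) : R := sin t * u - (1 - cos t) * v.
    have dF (t : R) : is_derive t 1 F (cos t * u - sin t * v).
      have h1 := is_deriveM (is_derive_sin t) (is_derive_cst u t 1).
      have h2 := is_deriveM (is_deriveB (is_derive_cst (1 : R) t 1) (is_derive_cos t))
        (is_derive_cst v t 1).
      apply: is_derive_eq (is_deriveB h1 h2) _.
      by rewrite !scaler0 !add0r opprK; congr (_ - _); exact: mulrC.
    have F0 : F 0 = 0 by rewrite /F sin0 cos0 subrr !mul0r subr0.
    have /eqP : cos 0 * u - sin 0 * v = 0.
      apply: (@derive_at_max R F (fun t => cos t * u - sin t * v) 0 1).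
      - exact: ltr01.
      - by move=> t _; rewrite F0; exact: hm.
    rewrite cos0 sin0 mul1r mul0r subr0.
    by rewrite subr_eq0 => /eqP.
  have -> : Y0 = g by rewrite -[g]mulmx1 -(SO_trR YSO) mulmxA -/Z Z1 mul1mx /Y trmxK.
  exact: Kx.
Qed.

End Density.

(** * Products of exponentials with prescribed logarithmic derivatives *)

Section Chain.
Variables (R : realType) (n : nat) (S : 'M[R]_n -> Prop).
Hypothesis HS : SO_semigroup S.
Hypothesis S_dense : forall Y, in_SO Y -> clos S Y.
Variables B0 Be : 'M[R]_n.
Hypothesis so_B0 : in_so B0.
Hypothesis so_Be : in_so Be.
Hypothesis S_exp : forall u t : R, 0 <= t -> S (mexp (B0 + u *: Be) t).
Variable I : finType.
Implicit Types (tau : I -> R) (P Q A : 'M[R]_n).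

Definition lip (C : R) (G : (I -> R) -> 'M[R]_n) :=
  forall e tau tau', 0 <= e -> (forall i, `|tau i - tau' i| <= e) ->
    small (C * e) (G tau - G tau').

Lemma lipW C C' G : C <= C' -> lip C G -> lip C' G.
Proof.
move=> CC' hG e tau tau' e0 h; apply: smallW (hG e _ _ e0 h).
by rewrite ler_wpM2r.
Qed.

Lemma small_conjB P Q A (a b : R) : in_SO P -> in_SO Q -> small a (P - Q) ->
  small b A -> small (n%:R * (n%:R * (a * b)) * 2) (P *m A *m P^T - Q *m A *m Q^T).
Proof.
move=> hP hQ ha hb.
have -> : P *m A *m P^T - Q *m A *m Q^T =
    (P - Q) *m A *m P^T + Q *m A *m (P - Q)^T.
  by rewrite [(P - Q)^T]raddfB /= mulmxBr !mulmxBl addrA subrK.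
rewrite mulr_natr mulr2n; apply: smallD.
  exact: small_SOr (SO_tr hP) (smallM ha hb).
rewrite -mulmxA; apply: small_SOl => //.
by rewrite [a * b]mulrC; apply: smallM => //; exact: small_tr.
Qed.

(** Derivatives are taken along lines: coordinate directions give the partial derivatives, and a
    segment gives the mean value estimate. *)
Definition along tau (sg : I -> R) (s : R) : I -> R := fun i => tau i + s * sg i.

(* [F] parametrizes a box in [S]; its logarithmic partial derivatives [V i] are
   [d]-close to the prescribed [T i] at the origin. *)
Definition chain (L : seq I) (T : I -> 'M[R]_n) (d : R)
    (F : (I -> R) -> 'M[R]_n) (V : I -> (I -> R) -> 'M[R]_n) (C : R) :=
  [/\ 0 <= C, forall tau, in_SO (F tau),
      forall tau, (forall i, `|tau i| <= 1) -> S (F tau),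
      forall tau sg s, mderiv (fun l => F (along tau sg l)) s
        ((\sum_(i <- L) sg i *: V i (along tau sg s)) *m F (along tau sg s)) &
      lip C F /\ forall i, i \in L ->
        [/\ lip C (V i), forall tau, in_so (V i tau) &
            small d (V i (fun=> 0) - T i)]].

(** Induction on [L], multiplying on the right by [g *m mexp W (1 + tau i)]. This keeps the earlier
    logarithmic derivatives and adds [P *m W *m P^T] with [P := F tau *m g]. By density [g] can
    bring [P] close to [Q] at the origin; with [W] close to [Be], the new derivative is close to
    [T i] there. *)
Lemma chain_exists (L : seq I) (T : I -> 'M[R]_n) (d : R) : 0 < d -> uniq L ->
  (forall i, exists2 Q, in_SO Q & T i = Q *m Be *m Q^T) ->
  exists F V C, chain L T d F V C.
Proof.
move=> d0 + hT; elim: L => [_|i L IH /= /andP[iL /IH]].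
  exists (fun=> 1%:M), (fun _ _ => 0), 0; split => //.
  - by move=> _; exact: SO1.
  - by move=> *; case: HS.
  - move=> tau sg s; rewrite big_nil mul0mx; exact: mderiv_cst.
  - by split=> // e tau tau' e0 _; rewrite subrr mul0r; exact: small0.
move=> [F [V [C [C0 FSO FS dF [lF hV]]]]].
have [Q QSO TQ] := hT i.
have d20 : 0 < d / 2 by rewrite divr_gt0.
pose b := mxsum Be; have b0 : 0 <= b := mxsum_ge0 Be.
have n0 : 0 <= n%:R :> R by exact: ler0n.
(* The error [d] is halved: [v] controls the drift term of [W], and [eta] the replacement of [P z]
   by [Q]. *)
have [v v0 hv] : exists2 v : R, 0 < v & n%:R * (n%:R * mxsum B0) * v <= d / 2.
  by apply: small_factor => //; rewrite !mulr_ge0 // mxsum_ge0.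
have [eta eta0 heta] : exists2 eta : R, 0 < eta &
    n%:R * (n%:R * (n%:R * b)) * 2 * eta <= d / 2.
  by apply: small_factor => //; rewrite !mulr_ge0 // ler0n.
pose z : I -> R := fun=> 0.
have [g Sg hg] := S_dense (SO_mul (SO_tr (FSO z)) QSO) eta0.
have gSO : in_SO g by case: HS => _ _; apply.
(* [W] is the positive multiple [v] of [B0 + v^-1 *: Be]: a large control value makes the drift
   negligible. *)
pose W := Be + v *: B0.
have soW : in_so W by apply: soD => //; exact: soZ.
pose c := mxsum W; have c0 : 0 <= c := mxsum_ge0 W.
pose P tau := F tau *m g.
have PSO tau : in_SO (P tau) by exact: SO_mul.
have lP : lip (n%:R * C) P.
  move=> e tau tau' e0 h; rewrite /P -mulmxBl -mulrA.
  by apply: small_SOr => //; exact: lF.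
pose nV tau := P tau *m W *m (P tau)^T.
(* The base duration 1 keeps [1 + tau i] nonnegative on the unit box. *)
pose nF tau := P tau *m mexp W (1 + tau i).
have lnV : lip (n%:R * (n%:R * (n%:R * C * c)) * 2) nV.
  move=> e tau tau' e0 h.
  have := small_conjB (PSO tau) (PSO tau') (lP e tau tau' e0 h) (@small_mxsum _ _ W).
  by apply: smallW; rewrite -/c; lra.
have lnF : lip (n%:R * (n%:R * c) + n%:R * (n%:R * C)) nF.
  move=> e tau tau' e0 h.
  have -> : nF tau - nF tau' = P tau *m (mexp W (1 + tau i) - mexp W (1 + tau' i)) +
      (P tau - P tau') *m mexp W (1 + tau' i).
    by rewrite /nF mulmxBr mulmxBl addrA subrK.
  rewrite mulrDl; apply: smallD.
    rewrite -mulrA; apply: small_SOl => //.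
    apply: smallW (mexp_lip (1 + tau' i) (1 + tau i) soW (@small_mxsum _ _ W)).
    rewrite -/c ler_wpM2l ?mulr_ge0 //.
    have -> : 1 + tau i - (1 + tau' i) = tau i - tau' i by ring.
    exact: h.
  by rewrite -mulrA; apply: small_SOr; [exact: mexp_SO | exact: lP].
pose K := C + n%:R * (n%:R * (n%:R * C * c)) * 2 +
  (n%:R * (n%:R * c) + n%:R * (n%:R * C)).
have K1 : 0 <= n%:R * (n%:R * (n%:R * C * c)) * 2 by rewrite !mulr_ge0.
have K2 : 0 <= n%:R * (n%:R * c) + n%:R * (n%:R * C) by rewrite addr_ge0 // !mulr_ge0.
exists nF, (fun j => if j == i then nV else V j), K; split.
- exact: addr_ge0 (addr_ge0 C0 K1) K2.
- by move=> tau; apply: SO_mul => //; exact: mexp_SO.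
- move=> tau htau; case: (HS) => _ SM _; apply: (SM _ _ (SM _ _ (FS _ htau) Sg)).
  have -> : W = v *: (B0 + v^-1 *: Be).
    by rewrite scalerDr scalerA divff ?gt_eqF // scale1r addrC.
  rewrite mexpZ; apply: S_exp; apply: mulr_ge0; first exact: ltW.
  by have := htau i; rewrite ler_norml => /andP[h _]; lra.
- move=> tau sg s.
  have h1 : mderiv (fun l => mexp W (1 + along tau sg l i)) s
     (sg i *: (W *m mexp W (1 + along tau sg s i))).
    have e l : 1 + tau i + sg i * l = 1 + along tau sg l i by rewrite /along; ring.
    rewrite -e; apply: mderiv_ext (fun l => congr1 (mexp W) (e l)) _.
    by apply: mderiv_affine; exact: mderiv_mexp.
  apply: mderiv_eq (mderivM (mderiv_mulmxr g (dF tau sg s)) h1) _.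
  rewrite /nF big_cons eqxx [RHS]mulmxDl addrC; congr (_ + _).
    rewrite /nV -scalemxAl -scalemxAr; congr (_ *: _).
    rewrite -/(P (along tau sg s)); move: (P _) (SO_trL (PSO (along tau sg s))) => X hX.
    by rewrite [RHS]mulmxA -[X *m W *m X^T *m X]mulmxA hX mulmx1 mulmxA.
  rewrite -!mulmxA; congr (_ *m _).
  apply: eq_big_seq => j jL.
  by case: eqP jL => [->|//]; rewrite (negPf iL).
- have CK : C <= K by rewrite /K -addrA lerDl; exact: addr_ge0.
  split; first by apply: lipW lnF; rewrite /K lerDr; exact: addr_ge0.
  move=> j; rewrite inE; case: eqP => [-> _|_ /= /hV [h1 h2 h3]]; last first.
    by split => //; exact: lipW h1.
  split.
  - by apply: lipW lnV; rewrite /K; lra.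
  - by move=> tau; exact: so_conj.
  have -> : nV (fun=> 0) - T i = (P z *m Be *m (P z)^T - Q *m Be *m Q^T) +
      P z *m (v *: B0) *m (P z)^T.
    by rewrite TQ /nV /W mulmxDr mulmxDl addrAC.
  have hPQ : small (n%:R * eta) (P z - Q).
    have -> : P z - Q = F z *m (g - (F z)^T *m Q).
      by rewrite mulmxBr mulmxA (SO_trR (FSO z)) mul1mx.
    by apply: small_SOl => //; exact: smallB.
  rewrite [d]splitr; apply: smallD.
    apply: smallW (small_conjB (PSO z) QSO hPQ (@small_mxsum _ _ Be)).
    by rewrite -/b; lra.
  apply: smallW (small_SO2 (PSO z) (SO_tr (PSO z)) (smallZ v (@small_mxsum _ _ B0))).
  by rewrite gtr0_norm //; lra.
Qed.

End Chain.

(** * Trace identities and rigidity of symmetric rotations near 1 *)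

Section Trace.
Variables (R : realType) (n : nat).
Implicit Types (A X Y Q : 'M[R]_n).
Local Notation B := (@Bbasis R n).

Lemma tr_delta (p q : 'I_n) X : \tr (delta_mx p q *m X) = X q p.
Proof.
rewrite /mxtrace (bigD1 p) //= big1 ?addr0 => [|k kp]; rewrite mxE.
  rewrite (bigD1 q) //= big1 ?addr0 => [|k kq]; rewrite mxE ?eqxx ?mul1r //.
  by rewrite (negPf kq) andbF mul0r.
by rewrite big1 // => l _; rewrite mxE (negPf kp) mul0r.
Qed.

Lemma tr_Bbasis (p q : 'I_n) X : \tr (B p q *m X) = X q p - X p q.
Proof. by rewrite /Bbasis mulmxBl raddfB /= !tr_delta. Qed.

Lemma tr_small (e : R) A X : small e A -> `|\tr (A *m X)| <= e * mxsum X.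
Proof.
move=> hA; apply: le_trans (ler_norm_sum _ _ _) _.
rewrite /mxsum exchange_big mulr_sumr; apply: ler_sum => a _.
rewrite mxE; apply: le_trans (ler_norm_sum _ _ _) _.
by rewrite mulr_sumr; apply: ler_sum => b _; rewrite normrM ler_wpM2r.
Qed.

Lemma mxsum_eq0 A : mxsum A <= 0 -> A = 0.
Proof.
move=> h; apply/matrixP => i j; rewrite mxE; apply/eqP; rewrite -normr_le0.
exact: le_trans (small_mxsum A i j) h.
Qed.

Lemma mxsum_le A (c : R) : small c A -> mxsum A <= n%:R * (n%:R * c).
Proof.
move=> h; rewrite /mxsum (@le_trans _ _ (\sum_(i < n) \sum_(j < n) c)) //.
  by apply: ler_sum => i _; apply: ler_sum => j _; exact: h.
by rewrite !sumr_const !card_ord !mulr_natl.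
Qed.

(** The trace of [B p q *m Q] is an entry of [Q^T - Q], and the skew perturbation [A] only sees
    [Q - Q^T]. So each entry of [Q - Q^T] is at most [d * M], where [M] sums their absolute values;
    then [M <= n ^ 2 * d * M <= M / 2], and [M = 0]. *)
Lemma sym_of_tr_eq0 (d : R) Q : 0 <= d -> n%:R * (n%:R * d) <= 2^-1 ->
  (forall p q : 'I_n, (p < q)%N -> exists A,
     [/\ in_so A, small (2 * d) A & \tr ((B p q + A) *m Q) = 0]) ->
  Q^T = Q.
Proof.
move=> d0 hd h; pose M := mxsum (Q - Q^T).
have M0 : 0 <= M := mxsum_ge0 _.
have hlt (p q : 'I_n) : (p < q)%N -> `|Q p q - Q q p| <= d * M.
  move=> /h [A [soA sA]].
  rewrite mulmxDl mxtraceD tr_Bbasis => hA.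
  have h2 : \tr (A *m (Q - Q^T)) = 2 * \tr (A *m Q).
    rewrite mulmxBr mxtraceD raddfN /=.
    have -> : \tr (A *m Q^T) = - \tr (A *m Q).
      rewrite -[LHS]mxtrace_tr trmx_mul trmxK soA mulmxN raddfN /=.
      by rewrite mxtrace_mulC.
    by ring.
  have hA' : \tr (A *m Q) = Q p q - Q q p by lra.
  have := tr_small (Q - Q^T) sA.
  by rewrite -/M h2 hA' normrM ger0_norm // -mulrA ler_pM2l.
have hall : small (d * M) (Q - Q^T).
  move=> p q; rewrite !mxE.
  have [pq|qp|/val_inj ->] := ltngtP p q.
  - exact: hlt.
  - by rewrite distrC; exact: hlt.
  - by rewrite subrr normr0 mulr_ge0.
have := mxsum_le hall; rewrite -/M => hM.
have : M <= 0.
  have : n%:R * (n%:R * d) * M <= 2^-1 * M by rewrite ler_wpM2r.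
  lra.
by move=> /mxsum_eq0/eqP; rewrite subr_eq0 => /eqP.
Qed.

(** Here [Q *m Q = 1], so [P := Q - 1] satisfies [P *m P = - 2 P], and for small [P] the left side
    is too small unless [P = 0]. *)
Lemma SO_sym_near1 (e : R) Q : in_SO Q -> Q^T = Q -> small e (Q - 1%:M) ->
  n%:R * e <= 1 -> Q = 1%:M.
Proof.
move=> QSO Qs; set P := Q - 1%:M => sP ne.
have PP : P *m P = - (2 *: P).
  rewrite /P mulmxBr mulmxBl mulmx1 mul1mx.
  have -> : Q *m Q = 1%:M by rewrite -{2}Qs SO_trR.
  by apply/matrixP => a b; rewrite !mxE; ring.
have h a b : 2 * `|P a b| <= e * \sum_c `|P c b|.
  have -> : 2 * `|P a b| = `|(P *m P) a b| by rewrite PP !mxE normrN normrM ger0_norm.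
  rewrite mxE; apply: le_trans (ler_norm_sum _ _ _) _; rewrite mulr_sumr.
  by apply: ler_sum => c _; rewrite normrM ler_wpM2r.
have hM : 2 * mxsum P <= n%:R * (e * mxsum P).
  rewrite {1}/mxsum mulr_sumr (@le_trans _ _ (\sum_(a < n) e * mxsum P)) //.
    apply: ler_sum => a _; rewrite mulr_sumr /mxsum exchange_big mulr_sumr.
    by apply: ler_sum => b _; exact: h.
  by rewrite sumr_const card_ord mulr_natl.
have /mxsum_eq0/eqP : mxsum P <= 0.
  have : n%:R * e * mxsum P <= 1 * mxsum P by rewrite ler_wpM2r // mxsum_ge0.
  by lra.
by rewrite subr_eq0 => /eqP.
Qed.

Lemma tr_sqr X : \tr (X *m X^T) = \sum_i \sum_j X i j ^+ 2.
Proof.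
by apply: eq_bigr => i _; rewrite mxE; apply: eq_bigr => j _; rewrite mxE expr2.
Qed.

(** On SO(n), maximizing the trace of [X *m Y^T] amounts to minimizing the Frobenius distance to
    [Y]. *)
Lemma SO_tr_dist X Y : in_SO X -> in_SO Y ->
  \tr ((X - Y) *m (X - Y)^T) = 2 * n%:R - 2 * \tr (X *m Y^T).
Proof.
move=> hX hY; rewrite raddfB /= mulmxBl !mulmxBr (SO_trR hX) (SO_trR hY).
rewrite !mxtraceD !raddfN /= !mxtraceD !raddfN /= !mxtrace1.
have -> : \tr (Y *m X^T) = \tr (X *m Y^T) by rewrite -[LHS]mxtrace_tr trmx_mul trmxK.
by ring.
Qed.

(** The comparison goes through the Frobenius norm, which is at most [n] times the entrywise
    maximum. *)
Lemma SO_closer (r : R) X X0 Y : in_SO X -> in_SO X0 -> in_SO Y -> 0 <= r ->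
  \tr (X0 *m Y^T) <= \tr (X *m Y^T) -> small r (X0 - Y) -> small (n%:R * r) (X - Y).
Proof.
move=> hX hX0 hY r0 hle hr.
have h1 : \tr ((X - Y) *m (X - Y)^T) <= (n%:R * r) ^+ 2.
  apply: (@le_trans _ _ (\tr ((X0 - Y) *m (X0 - Y)^T))).
    by rewrite !SO_tr_dist //; lra.
  rewrite tr_sqr (@le_trans _ _ (\sum_(i < n) \sum_(j < n) r ^+ 2)) //.
    apply: ler_sum => i _; apply: ler_sum => j _.
    by rewrite -real_normK ?num_real // lerXn2r ?nnegrE //; exact: hr.
  by rewrite !sumr_const !card_ord exprMn [n%:R ^+ 2]expr2 -mulrA !mulr_natl.
move=> i j; rewrite -(ler_pXn2r (n := 2)) ?nnegrE ?mulr_ge0 //.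
apply: le_trans h1; rewrite real_normK ?num_real // tr_sqr (bigD1 i) //= (bigD1 j) //=.
rewrite -addrA lerDl addr_ge0 ?sumr_ge0 // => *; rewrite ?sqr_ge0 // sumr_ge0 // => *.
exact: sqr_ge0.
Qed.

Lemma mderiv_mxtrace (F : R -> 'M[R]_n) t A : mderiv F t A ->
  is_derive t 1 (fun s => \tr (F s)) (\tr A).
Proof.
move=> hF; rewrite (_ : (fun s => _) = \sum_(i < n) (fun s => F s i i)).
  exact: is_derive_sum.
by apply/funext => s; rewrite fct_sumE.
Qed.

End Trace.

Lemma MVT01 (R : realType) (f df : R -> R) : (forall t : R, is_derive t 1 f (df t)) ->
  exists2 c, 0 <= c <= 1 & f 1 - f 0 = df c.
Proof.
move=> hf.
have cf : {within `[0, 1], continuous f}.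
  apply/continuous_subspaceT => x.
  by apply/differentiable_continuous/derivable1_diffP; case: (hf x).
have [c] := MVT_segment ler01 (fun x _ => hf x) cf.
by rewrite in_itv /= subr0 mulr1 => hc h; exists c.
Qed.

(** * An open subset of the semigroup, and the passage from dense to full *)

Section Interior.
Variables (R : realType) (n : nat).
Local Notation B := (@Bbasis R n).

(** Quarter turns replace the second index. A half turn in the plane of the second index and a third
    one changes the sign, which exchanges the two indices; [2 < n] supplies the third. *)
Lemma Bbasis_orbit (a b p q : 'I_n) : (2 < n)%N -> a != b -> p != q ->
  exists2 Q, in_SO Q & B p q = Q *m B a b *m Q^T.
Proof.
move=> n3 ab pq.
pose T (i j : 'I_n) := exists2 Q, in_SO Q & B i j = Q *m B a b *m Q^T.
have conj i j X : T i j -> in_so X -> forall t,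
    exists2 Q, in_SO Q & mexp X t *m B i j *m mexp X (- t) = Q *m B a b *m Q^T.
  move=> [Q QSO ->] soX t; exists (mexp X t *m Q).
    by apply: SO_mul => //; exact: mexp_SO.
  by rewrite trmx_mul (mexp_so _ soX) !mulmxA.
have stepR i j k : i != j -> i != k -> T i j -> T i k.
  move=> ij ik hT; have [<-//|jk] := eqVneq j k.
  have [Q QSO] := conj i j (B j k) hT (Bbasis_so _ _ _) (- (pi / 2)).
  rewrite (mexp_Bbasis_conj _ ij jk ik).
  rewrite cosN sinN cos_pihalf sin_pihalf scale0r scaleN1r opprK add0r.
  by exists Q.
have stepC i j : i != j -> T i j -> T j i.
  move=> ij hT.
  have [k] : exists k : 'I_n, k \notin [set i; j]%SET.
    apply/existsP; rewrite -negb_forall; apply/negP => /forallP h.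
    have : (#|'I_n| <= #|[set i; j]%SET|)%N.
      by apply: subset_leq_card; apply/fintype.subsetP => k _; exact: h.
    by rewrite card_ord cards2 ij leqNgt n3.
  rewrite !inE negb_or => /andP[ki kj].
  have jk : j != k by rewrite eq_sym.
  have ik : i != k by rewrite eq_sym.
  have [Q QSO] := conj i j (B j k) hT (Bbasis_so _ _ _) pi.
  rewrite (mexp_Bbasis_conj _ ij jk ik).
  rewrite cospi sinpi scale0r scaleN1r subr0 -BbasisC.
  by exists Q.
have hab : T a b by exists 1%:M; [exact: SO1 | rewrite mul1mx trmx1 mulmx1].
have qp : q != p by rewrite eq_sym.
have [qa|qa] := eqVneq q a.
  by rewrite qa in pq qp *; apply: stepC => //; exact: (stepR _ b).
have aq : a != q by rewrite eq_sym.
apply: (stepC) => //; apply: (stepR _ a) => //; apply: stepC => //.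
exact: (stepR _ b).
Qed.

Local Notation upair := {pq : 'I_n * 'I_n | (pq.1 < pq.2)%N}.
Definition upairB (i : upair) : 'M[R]_n := B (val i).1 (val i).2.

Lemma upair_neq (i : upair) : (val i).1 != (val i).2.
Proof. by rewrite neq_ltn (valP i). Qed.

Lemma small_upairB i : small 1 (upairB i).
Proof.
move=> a b; rewrite !mxE.
by do 2 case: (_ && _); rewrite ?subrr ?subr0 ?sub0r ?normrN ?normr1 ?normr0 ?ler01.
Qed.

(** Orthogonality for the trace form: pairing with [upairB i] reads off the coordinate [i]. *)
Lemma tr_upairB (i j : upair) : \tr (upairB i *m upairB j) = - 2 * (i == j)%:R.
Proof.
have -> : (i == j) = ((val i).1 == (val j).1) && ((val i).2 == (val j).2).
  by rewrite -val_eqE [LHS]xpair_eqE.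
rewrite /upairB tr_Bbasis !mxE.
case: i => -[a b] /= ab; case: j => -[c d] /= cd.
have -> : (b == c) && (a == d) = false.
  by apply/negP => /andP[/eqP bc /eqP ad]; move: ab; rewrite bc ad => /(ltn_trans cd); rewrite ltnn.
have -> : (b == d) && (a == c) = (a == c) && (b == d) by rewrite andbC.
have -> : (a == d) && (b == c) = false.
  by apply/negP => /andP[/eqP ad /eqP bc]; move: ab; rewrite bc ad => /(ltn_trans cd); rewrite ltnn.
by case: ((a == c) && (b == d)) => /=; ring.
Qed.

Variable S : 'M[R]_n -> Prop.

(** Let [x] maximize the trace of [F tau *m Y^T] over the box of radius [r]. For [Y] close to [F] at
    the origin the maximum is interior, so every [V i x] has trace zero against [F x *m Y^T]. This
    matrix is then symmetric and near 1, hence equal to 1. *)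
Lemma chain_open (d : R) F V C : chain S (enum {: upair}) upairB d F V C ->
  0 < d -> 4 * #|{: upair}|%:R * d <= 1 -> n%:R * (n%:R * d) <= 2^-1 -> 2 * d <= 1 ->
  exists2 r : R, 0 < r &
    forall Y, in_SO Y -> small r (F (fun=> 0) - Y) -> S Y.
Proof.
move=> [C0 FSO FS dF [lF hV]] d0 hN hnd hd.
have hVi i : [/\ lip C (V i), forall tau, in_so (V i tau) &
    small d (V i (fun=> 0) - upairB i)] by apply: hV; rewrite mem_enum.
pose z : upair -> R := fun=> 0.
have n0 : 0 <= n%:R :> R by exact: ler0n.
(* With [K * r <= d], both [V i tau] and [V i tau *m F tau *m (F z)^T] stay within [2 * d] of
   [upairB i] on the box. *)
pose K := C + n%:R * (n%:R * (2 * C)).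
have K0 : 0 <= K by rewrite addr_ge0 // !mulr_ge0.
have [r1 r10 hr1] := small_factor K0 d0.
pose r := Num.min r1 1.
have r0 : 0 < r by rewrite lt_min r10 ltr01.
have r0w : 0 <= r := ltW r0.
have rle1 : r <= 1 by rewrite ge_min lexx orbT.
have hr : K * r <= d.
  by apply: le_trans hr1; apply: ler_wpM2l => //; rewrite ge_min lexx.
have Cr0 : 0 <= C * r by rewrite mulr_ge0 // ltW.
have nCr0 : 0 <= n%:R * (n%:R * (2 * (C * r))) by rewrite !mulr_ge0.
have hKr : C * r + n%:R * (n%:R * (2 * (C * r))) <= d.
  by apply: le_trans hr; rewrite /K; lra.
pose box (tau : upair -> R) := forall i : upair, `|tau i| <= r.
have hz tau : box tau -> forall i, `|tau i - z i| <= r.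
  by move=> h i; rewrite subr0.
have hA tau i : box tau -> small (2 * d) (V i tau - upairB i).
  move=> /hz h; have [lV _ sV] := hVi i.
  rewrite -(subrK (V i z) (V i tau)) -addrA.
  apply: smallW (smallD (lV r tau z (ltW r0) h) sV); lra.
have hM tau i : box tau ->
    small (2 * d) (V i tau *m F tau *m (F z)^T - upairB i).
  move=> hb; have [lV _ sV] := hVi i; have h := hz _ hb.
  have -> : V i tau *m F tau *m (F z)^T - upairB i =
      V i tau *m (F tau - F z) *m (F z)^T + ((V i tau - V i z) + (V i z - upairB i)).
    rewrite mulmxBr mulmxBl -[V i tau *m F z *m _]mulmxA (SO_trR (FSO z)) mulmx1.
    by rewrite [V i tau - _ + _]addrA subrK addrA subrK.
  have V2 : small 2 (V i tau).
    rewrite -(subrK (upairB i) (V i tau)).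
    apply: smallW (smallD (hA tau i hb) (small_upairB i)); lra.
  have := smallD (small_SOr (SO_tr (FSO z)) (smallM V2 (lF r tau z (ltW r0) h)))
    (smallD (lV r tau z (ltW r0) h) sV).
  apply: smallW; lra.
(* The first term excludes a maximum on the boundary, the second puts [F x *m Y^T] close enough to 1
   for [SO_sym_near1]. *)
pose cst := 4 * n%:R * (n%:R + 1) + n%:R * (n%:R * n%:R) : R.
have [rho rho0 hrho] : exists2 rho, 0 < rho & cst * rho <= r.
  by apply: small_factor => //; rewrite addr_ge0 // !mulr_ge0 // addr_ge0.
have pos1 : 0 <= n%:R * (n%:R * n%:R) * rho by rewrite !mulr_ge0 // ltW.
have pos2 : 0 <= n%:R * (n%:R + 1) * rho.
  by rewrite !mulr_ge0 ?addr_ge0 // ltW.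
have rho1 : 4 * (n%:R * (n%:R + 1) * rho) <= r.
  by apply: le_trans hrho; rewrite /cst; lra.
have rho2 : n%:R * (n%:R * n%:R) * rho <= 1.
  by apply: le_trans rle1; apply: le_trans hrho; rewrite /cst; lra.
exists rho => // Y YSO hY.
pose f tau := \tr (F tau *m Y^T).
have [|||||| x Kx hx] := @bounded_closed_max R {: upair} box f r (C * mxsum Y^T) z.
- by move=> y h i; exact: h.
- move=> y h i; apply/ler_addgt0Pr => e /h [w hw hyw].
  rewrite -(subrK (w i) (y i)) addrC.
  by apply: le_trans (ler_normD _ _) _; apply: lerD; [exact: hw | exact/ltW/hyw].
- exact: ltW.
- by rewrite mulr_ge0 // mxsum_ge0.
- move=> y w e e0 _ _ h; rewrite /f -raddfB -mulmxBl mulrAC.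
  by apply: tr_small; exact: lF.
- by move=> i; rewrite normr0 ltW.
have zbox : box z by move=> i; rewrite normr0 ltW.
have sFY : small (n%:R * rho) (F x - Y).
  by apply: SO_closer hY => //; [exact: ltW | exact: hx].
have sFF : small (n%:R * rho + rho) (F x - F z).
  by rewrite -(subrK Y (F x)) -addrA; apply: smallD => //; exact: smallB.
(* On the boundary, the mean value theorem along the segment from the origin to [x] shows that
   [upairB i] paired with the displacement gives [- 2 * x i] up to [r]. By [sFF] the pairing is at
   most [r / 2], a contradiction. *)
have [[i ri]|nb] := pselect (exists i, r <= `|x i|).
  exfalso.
  pose phi l := \tr (upairB i *m (F (along z x l) *m (F z)^T)).
  pose dphi l := \sum_j x j * \tr (upairB i *m
    (V j (along z x l) *m F (along z x l) *m (F z)^T)).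
  have hphi (l : R) : is_derive l 1 phi (dphi l).
    have := mderiv_mxtrace (mderiv_mulmxl (upairB i)
       (mderiv_mulmxr (F z)^T (dF z x l))).
    move=> /is_derive_eq; apply.
    rewrite /dphi big_enum /= !mulmx_suml mulmx_sumr raddf_sum.
    apply: eq_bigr => j _.
    by rewrite /= -!scalemxAl -scalemxAr mxtraceZ.
  have [c c01] := MVT01 hphi.
  have m1 : along z x 1 = x by apply/funext => j; rewrite /along add0r mul1r.
  have m0 : along z x 0 = z by apply/funext => j; rewrite /along mul0r addr0.
  rewrite /phi m1 m0 -raddfB -mulmxBr -mulmxBl => hc.
  have cbox : box (along z x c).
    move=> j; rewrite /along add0r normrM ger0_norm; last by case/andP: c01.
    rewrite (le_trans _ (Kx j)) // ler_piMl //; by case/andP: c01.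
  have trB e X : small e X -> `|\tr (upairB i *m X)| <= e + e.
    by move=> sX; rewrite tr_Bbasis (le_trans (ler_normB _ _)) // lerD.
  have h1 := trB _ _ (small_SOr (SO_tr (FSO z)) sFF).
  have h2 : `|dphi c + 2 * x i| <= r.
    have -> : dphi c + 2 * x i = \sum_j x j * \tr (upairB i *m
        (V j (along z x c) *m F (along z x c) *m (F z)^T - upairB j)).
      have -> : 2 * x i = \sum_j x j * (2 * (i == j)%:R).
        rewrite (bigD1 i) //= big1 ?addr0 => [|j ji]; first by rewrite eqxx mulr1 mulrC.
        by rewrite eq_sym (negPf ji) !mulr0.
      rewrite -big_split /=; apply: eq_bigr => j _.
      by rewrite mulmxBr mxtraceD raddfN /= tr_upairB -mulrDr mulNr opprK.
    apply: le_trans (ler_norm_sum _ _ _) _.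
    apply: (@le_trans _ _ (\sum_(j : upair) r * (4 * d))).
      apply: ler_sum => j _; rewrite normrM ler_pM //.
      by apply: le_trans (trB _ _ (hM _ j cbox)) _; lra.
    rewrite sumr_const -mulr_natr.
    have : r * (4 * #|{: upair}|%:R * d) <= r * 1 by rewrite ler_wpM2l // ltW.
    lra.
  rewrite hc in h1.
  have h3 : 2 * `|x i| <= `|dphi c + 2 * x i| + `|dphi c|.
    have -> : 2 * `|x i| = `|dphi c + 2 * x i - dphi c|.
      by rewrite addrC addKr normrM ger0_norm.
    exact: ler_normB.
  have : r < r by lra.
  by rewrite ltxx.
have xlt i : `|x i| < r.
  by rewrite ltNge; apply/negP => h; apply: nb; exists i.
have crit i : \tr (V i x *m (F x *m Y^T)) = 0.
  pose sg (j : upair) : R := (j == i)%:R.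
  pose g l := \tr (F (along x sg l) *m Y^T).
  pose dg l := \tr (V i (along x sg l) *m (F (along x sg l) *m Y^T)).
  have hg (l : R) : is_derive l 1 g (dg l).
    have := mderiv_mxtrace (mderiv_mulmxr Y^T (dF x sg l)).
    move=> /is_derive_eq; apply; rewrite /dg big_enum /= (bigD1 i) //= big1 => [|j ji].
      by rewrite /sg eqxx scale1r addr0 mulmxA.
    by rewrite /sg (negPf ji) scale0r.
  have m0 : along x sg 0 = x by apply/funext => j; rewrite /along mul0r addr0.
  have := @derive_at_max R g dg 0 (r - `|x i|) _ hg.
  rewrite /dg m0; apply; first by rewrite subr_gt0.
  move=> l; rewrite subr0 => hl; rewrite /g m0; apply: hx => j.
  rewrite /along /sg; have [->|_] := eqVneq j i; last by rewrite mulr0 addr0.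
  by rewrite mulr1; apply: le_trans (ler_normD _ _) _; lra.
have QSO : in_SO (F x *m Y^T) by apply: SO_mul => //; exact: SO_tr.
have Qsym : (F x *m Y^T)^T = F x *m Y^T.
  apply: (@sym_of_tr_eq0 _ _ d); [exact: ltW | exact: hnd | move=> p q pq].
  pose i : upair := exist _ (p, q) pq.
  have [_ soV _] := hVi i.
  exists (V i x - upairB i); split.
  - by rewrite -scaleN1r; apply: soD => //; apply: soZ; exact: Bbasis_so.
  - exact: hA.
  - have -> : B p q + (V i x - upairB i) = V i x by rewrite addrC subrK.
    exact: crit.
have Q1 : F x *m Y^T = 1%:M.
  apply: (@SO_sym_near1 _ _ (n%:R * (n%:R * rho))) => //.
    have -> : F x *m Y^T - 1%:M = (F x - Y) *m Y^T by rewrite mulmxBl (SO_trR YSO).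
    by apply: small_SOr => //; exact: SO_tr.
  by apply: le_trans rho2; lra.
have <- : F x = Y.
  by rewrite -[F x]mulmx1 -(SO_trL YSO) mulmxA Q1 mul1mx.
by apply: FS => i; exact: le_trans (Kx i) rle1.
Qed.

(** [S] contains a neighbourhood in SO(n) of some [X]. Density gives [s] in [S] close to [Y *m X^T];
    then [s^T *m Y] is close to [X], hence in [S], and so is [Y = s *m (s^T *m Y)]. *)
Lemma dense_full (B0 : 'M[R]_n) (a b : 'I_n) : (2 < n)%N -> a != b ->
  SO_semigroup S -> in_so B0 ->
  (forall u t : R, 0 <= t -> S (mexp (B0 + u *: B a b) t)) ->
  (forall Y, in_SO Y -> clos S Y) -> forall Y, in_SO Y -> S Y.
Proof.
move=> n3 ab HS so0 hexp hd Y YSO.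
have n0 : 0 <= n%:R :> R by exact: ler0n.
pose N : R := #|{: upair}|%:R.
have N0 : 0 <= N by exact: ler0n.
(* One summand for each of the three smallness conditions of [chain_open]. *)
have [d d0 hdd] : exists2 d : R, 0 < d & (4 * N + n%:R * n%:R + 2) * d <= 2^-1.
  by apply: small_factor; rewrite ?invr_gt0 // !addr_ge0 // mulr_ge0.
have p1 : 0 <= N * d by rewrite mulr_ge0 // ltW.
have p2 : 0 <= n%:R * n%:R * d by rewrite !mulr_ge0 // ltW.
have [F [V [C hch]]] : exists F V C, chain S (enum {: upair}) upairB d F V C.
  apply: (@chain_exists R n S HS hd B0 (B a b)) => //.
  - exact: Bbasis_so.
  - exact: enum_uniq.
  - by move=> i; apply: Bbasis_orbit => //; exact: upair_neq.
have [r r0 hr] : exists2 r : R, 0 < r &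
    forall Y, in_SO Y -> small r (F (fun=> 0) - Y) -> S Y.
  by apply: (chain_open hch) => //; rewrite -?/N; lra.
have [_ FSO _ _ _] := hch.
set X := F (fun=> 0) in hr.
have XSO : in_SO X by exact: FSO.
have [e e0 he] := small_factor (mulr_ge0 n0 n0) r0.
have [s Ss hs] := hd _ (SO_mul YSO (SO_tr XSO)) e e0.
have [_ SM S_SO] := HS; have sSO := S_SO _ Ss.
have -> : Y = s *m (s^T *m Y) by rewrite mulmxA (SO_trR sSO) mul1mx.
apply: SM => //; apply: hr; first by apply: SO_mul => //; exact: SO_tr.
have -> : X - s^T *m Y = s^T *m (s - Y *m X^T) *m X.
  rewrite mulmxBr mulmxBl (SO_trL sSO) mul1mx -!mulmxA (SO_trL XSO).
  by rewrite mulmx1.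
apply: smallW (small_SO2 (SO_tr sSO) XSO (smallB hs)).
by rewrite mulrA.
Qed.

End Interior.

(** * Piecewise constant controls and concatenation of trajectories *)

Section Trajectories.
Variables (R : realType) (n m : nat) (B0 : 'M[R]_n) (Bs : 'I_m -> 'M[R]_n).
Implicit Types (X Y : 'M[R]_n) (t T : R).

Definition field_of (c : 'I_m -> R) : 'M[R]_n := B0 + \sum_(k < m) c k *: Bs k.

(** The end points under piecewise constant controls; a new factor goes on the left because the last
    piece of a trajectory acts last. *)
Inductive reach : 'M[R]_n -> Prop :=
| reach1 : reach 1%:M
| reachM c t Y : 0 <= t -> reach Y -> reach (mexp (field_of c) t *m Y).

Lemma reach_exp c t : 0 <= t -> reach (mexp (field_of c) t).
Proof. by move=> t0; rewrite -[mexp _ _]mulmx1; exact: reachM reach1. Qed.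

Lemma reach_semigroup : in_so B0 -> (forall k, in_so (Bs k)) -> SO_semigroup reach.
Proof.
move=> so0 soB; split; first exact: reach1.
  by move=> X Y; elim=> [|c t Z t0 _ IH] hY;
     [rewrite mul1mx | rewrite -mulmxA; apply: reachM => //; exact: IH].
move=> X; elim=> [|c t Y t0 _ hY]; first exact: SO1.
apply: SO_mul => //; apply: mexp_SO; apply: soD => //; apply: so_sum => k _.
exact: soZ.
Qed.

Lemma near_eq_cvg_to (F : set_system R) (FF : Filter F) (f g : R -> R) (l : R) :
  (\forall x \near F, f x = g x) -> f @ F --> l -> g @ F --> l.
Proof. by move=> fg; apply: cvg_trans; exact: near_eq_cvg. Qed.

Lemma piecewise_continuous_extend (u : R -> R) (c T t : R) : 0 <= T -> 0 <= t ->
  piecewise_continuous u T ->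
  piecewise_continuous (fun s => if s < T then u s else c) (T + t).
Proof.
move=> T0 t0 [s [hc [hr hl]]]; exists (T :: s); split; [|split].
- move=> x /andP[x0 xT]; rewrite inE negb_or => /andP[xneT xs].
  have [xltT|Tlex] := ltP x T.
    apply: near_eq_cvg_to (hc x _ xs); last by rewrite x0.
    by near=> y; have -> : y < T by near: y; exact: lt_nbhsl.
  have Tltx : T < x by rewrite lt_neqAle eq_sym xneT.
  apply: cvg_near_cst; near=> y.
  have /ltW : T < y by near: y; exact: lt_nbhsr.
  by rewrite leNgt => /negPf ->.
- move=> x /andP[x0 xT]; have [xltT|Tlex] := ltP x T.
    have [|l hl'] := hr x; first by rewrite x0.
    exists l; apply: near_eq_cvg_to hl'.
    by near=> y; have -> : y < T by near: y; exact: nbhs_right_lt.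
  exists c; apply: cvg_near_cst; near=> y.
  have : x < y by near: y; exact: nbhs_right_gt.
  by move=> /(le_lt_trans Tlex)/ltW; rewrite leNgt => /negPf ->.
- move=> x /andP[x0 xT]; have [xleT|Tltx] := leP x T.
    have [|l hl'] := hl x; first by rewrite x0.
    exists l; apply: near_eq_cvg_to hl'; near=> y.
    have : y < x by near: y; exact: nbhs_left_lt.
    by move=> /lt_le_trans/(_ xleT) ->.
  exists c; apply: cvg_near_cst; near=> y.
  have /ltW : T < y by near: y; exact: nbhs_left_gt.
  by rewrite leNgt => /negPf ->.
Unshelve. all: by end_near. Qed.

(** After time [T] the trajectory follows the exponential from [Y]. The two pieces agree at [T],
    which gives continuity, and [T] joins the exceptional times of the differential equation. *)
Lemma attainable_extend c t Y : in_so (field_of c) -> 0 <= t ->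
  attainable B0 Bs Y -> attainable B0 Bs (mexp (field_of c) t *m Y).
Proof.
move=> soW t0 [T [u [X [T0 [hu [[X0 [XSO [Xc [s Xd]]]] XT]]]]]].
set W := field_of c in soW *.
pose Z x := mexp W (x - T) *m Y.
have ZT : Z T = X T by rewrite /Z subrr mexp0 mul1mx XT.
have dZ x : mderiv Z x (W *m Z x).
  rewrite /Z mulmxA; apply: mderiv_mulmxr.
  have e y : - T + 1 * y = y - T by rewrite mul1r addrC.
  rewrite -e; apply: mderiv_ext (fun y => congr1 (mexp W) (e y)) _.
  by apply: mderiv_eq (mderiv_affine (mderiv_mexp W _)) _; rewrite scale1r.
pose X' x := if x < T then X x else Z x.
have X'l x : x <= T -> X' x = X x.
  by rewrite /X' le_eqVlt => /predU1P[->|->//]; rewrite ltxx.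
have X'r x : T <= x -> X' x = Z x by rewrite /X' leNgt => /negPf ->.
exists (T + t), (fun k x => if x < T then u k x else c k), X'.
have Tt : T <= T + t by rewrite lerDl.
split; first by rewrite addr_ge0.
split; first by move=> k; exact: piecewise_continuous_extend.
split; last by rewrite X'r // /Z addrC addKr.
split; first by rewrite X'l.
split.
  move=> x /andP[x0 xT]; have [xle|/ltW xge] := leP x T.
    by rewrite X'l //; apply: XSO; rewrite x0.
  rewrite X'r //; apply: SO_mul; first exact: mexp_SO.
  by rewrite -XT; apply: XSO; rewrite T0 lexx.
split.
  move=> i j.
  have -> : `[0, T + t]%classic = `[0, T]%classic `|` `[T, T + t]%classic.
    apply/seteqP; split=> x /=; rewrite !in_itv /=.
      move=> /andP[x0 xT]; have [xle|/ltW xge] := leP x T; first by left; rewrite x0.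
      by right; rewrite xge.
    by move=> [/andP[x0 xT]|/andP[x0 xT]]; rewrite ?x0 ?xT ?(le_trans xT) ?(le_trans T0).
  apply: withinU_continuous; [exact: itv_closed | exact: itv_closed | |].
    apply: subspace_eq_continuous (Xc i j) => x.
    by rewrite inE /= in_itv /= => /andP[_ xT]; rewrite /from_subspace X'l.
  apply: (@subspace_eq_continuous _ _ _ (fun x => Z x i j)).
    by move=> x; rewrite inE /= in_itv /= => /andP[xT _]; rewrite /from_subspace X'r.
  apply: continuous_subspaceT => x.
  by apply/differentiable_continuous/derivable1_diffP; case: (dZ x i j).
exists (T :: s) => x /andP[x0 xT]; rewrite inE negb_or => /andP[xneT xs] i j.
have [xltT|Tlex] := ltP x T.
  rewrite X'l ?ltW //; apply: near_eq_is_derive (Xd x _ xs i j); last by rewrite x0.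
  near=> y; rewrite X'l // ltW //; near: y; exact: lt_nbhsl.
have Tltx : T < x by rewrite lt_neqAle eq_sym xneT.
rewrite X'r //; apply: near_eq_is_derive (dZ x i j).
near=> y; rewrite X'r // ltW //; near: y; exact: lt_nbhsr.
Unshelve. all: by end_near. Qed.

Lemma attainable1 : attainable B0 Bs 1%:M.
Proof.
exists 0, (fun _ _ => 0), (fun=> 1%:M); split=> //; split.
  move=> k; exists [::]; split; [|split].
  - by move=> x _ _; exact: cvg_cst.
  - by move=> x _; exists 0; exact: cvg_cst.
  - by move=> x _; exists 0; exact: cvg_cst.
split=> //; split=> //; split; first by move=> x _; exact: SO1.
split; first by move=> i j; apply: continuous_subspaceT => x; exact: cvg_cst.
by exists [::] => x /andP[x0 x1]; have := lt_trans x0 x1; rewrite ltxx.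
Qed.

Lemma reach_attainable : in_so B0 -> (forall k, in_so (Bs k)) ->
  forall Y, reach Y -> attainable B0 Bs Y.
Proof.
move=> so0 soB Y; elim=> [|c t Z t0 _ IH]; first exact: attainable1.
apply: attainable_extend => //; apply: soD => //; apply: so_sum => k _; exact: soZ.
Qed.

Lemma field_of_delta (k : 'I_m) (v : R) :
  field_of (fun l => if l == k then v else 0) = B0 + v *: Bs k.
Proof.
rewrite /field_of (bigD1 k) //= eqxx big1 ?addr0 // => l lk.
by rewrite (negPf lk) scale0r.
Qed.

End Trajectories.

(** * A drift that is nonzero on every drift edge *)

Section GenericDrift.
Variables (R : realType) (n : nat).

(** A nonzero polynomial has fewer than [size p] roots, so one of the first [size p] natural numbers
    is not a root. *)
Lemma poly_nonroot (p : {poly R}) : p != 0 -> exists x, ~~ root p x.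
Proof.
move=> p0; pose rs : seq R := [seq k%:R | k <- iota 0 (size p)].
have urs : uniq rs.
  by rewrite map_inj_uniq ?iota_uniq // => a b /eqP; rewrite eqr_nat => /eqP.
have : ~~ all (root p) rs.
  by apply/negP => h; have := max_poly_roots p0 h urs; rewrite size_map size_iota ltnn.
by move=> /allPn [x _ hx]; exists x.
Qed.

(* The coefficients are powers of a point avoiding the roots of the polynomials
   [\sum_k (A_k i j) 'X^k]. *)
Lemma generic_drift (As : seq 'M[R]_n) : (forall A, A \in As -> in_so A) ->
  exists B0, [/\ rigid_pattern As B0, in_so B0 &
    forall i j, drift_rel As i j -> B0 i j != 0].
Proof.
move=> soA; pose U := undup As.
pose P i j := \poly_(k < size U) (nth 0 U k i j).
(* The factor ['X] makes [x], hence every coefficient, nonzero, as the rigid pattern demands. A zero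
   [P i j] becomes 1: such pairs are not drift edges. *)
pose PP := 'X * \prod_i \prod_j (if P i j == 0 then 1 else P i j).
have PP0 : PP != 0.
  rewrite mulf_neq0 ?polyX_eq0 //; apply/prodf_neq0 => i _; apply/prodf_neq0 => j _.
  by case: ifP => [_|/negbT//]; exact: oner_neq0.
have [x] := poly_nonroot PP0; rewrite rootM negb_or rootX => /andP[x0 hx].
pose l (g : 'M[R]_n) := x ^+ index g U.
exists (\sum_(g <- U) l g *: g); split.
- by exists l; split=> // g _; rewrite expf_neq0.
- rewrite big_seq; apply: so_sum => g; rewrite mem_undup => /soA; exact: soZ.
- move=> i j /andP[_ /hasP [A hA Aij]].
  have Pij : P i j != 0.
    apply/eqP => /polyP /(_ (index A U)); rewrite coef0 coef_poly.
    have AU : A \in U by rewrite mem_undup.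
    by rewrite index_mem AU nth_index // => /eqP; rewrite (negPf Aij).
  have -> : (\sum_(g <- U) l g *: g) i j = (P i j).[x].
    rewrite horner_poly (big_nth 0) big_mkord summxE; apply: eq_bigr => k _.
    by rewrite mxE mulrC /l index_uniq // undup_uniq.
  move: hx; apply: contraNneq => Px.
  rewrite rootE !horner_prod; apply/prodf_eq0; exists i => //.
  rewrite horner_prod; apply/prodf_eq0; exists j => //.
  by rewrite (negPf Pij) Px.
Qed.

End GenericDrift.

(** * Structural controllability from the two graphs *)

Unset Implicit Arguments.

Theorem theorem1 (R : realType) (n : nat) (As : seq 'M[R]_n) (E : seq ('I_n * 'I_n)) :
  (2 <= n)%N ->
  (1 <= size As)%N ->
  (forall A, A \in As -> in_so A) ->
  (forall p, p \in E -> (p.1 < p.2)%N) ->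
  components_ge3 (contr_rel E) ->
  graph_connected (union_rel (drift_rel As) (contr_rel E)) ->
  structurally_controllable_SO As [seq @Bbasis R n p.1 p.2 | p <- E].
Proof.
move=> n2 _ soA ltE h3 hc.
have [B0 [rB0 so0 hB0]] := generic_drift soA.
pose i0 : 'I_n := Ordinal (ltnW n2).
have n3 : (2 < n)%N.
  by apply: leq_trans (h3 i0) _; apply: leq_trans (max_card _) _; rewrite card_ord.
(* The component of [i0] has another node, and the first step of a path to it is a control edge. *)
have [p0 p0E] : exists p, p \in E.
  have : (1 < #|[set j | connect (contr_rel E) i0 j]%classic|)%N by exact: ltnW (h3 i0).
  move=> /card_gt1P [x [y [/set_mem hx /set_mem hy xy]]].
  have [z iz hz] : exists2 z, i0 != z & connect (contr_rel E) i0 z.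
    have [xi|xi] := eqVneq i0 x; last by exists x.
    by exists y => //; rewrite xi.
  case/connectP: hz => -[|w p] /=; first by move=> _ zi; rewrite zi eqxx in iz.
  by move=> /andP[/andP[_ /orP[h|h]] _] _; [exists (i0, w) | exists (w, i0)].
pose m := size E.
pose Bs (k : 'I_m) := @Bbasis R n (tnth (in_tuple E) k).1 (tnth (in_tuple E) k).2.
have soB k : in_so (Bs k) by exact: Bbasis_so.
have hk p : p \in E -> exists k, Bs k = @Bbasis R n p.1 p.2.
  by move=> /(tnthP (in_tuple E)) [k ->]; exists k.
pose S := reach B0 Bs.
have HS : SO_semigroup S by exact: reach_semigroup.
have Sexp k v t : 0 <= t -> S (mexp (B0 + v *: Bs k) t).
  by move=> t0; rewrite -field_of_delta; exact: reach_exp.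
have lieW k v : lie S (B0 + v *: Bs k).
  apply: (lie_pos HS) => [|t t0]; first by apply: soD => //; exact: soZ.
  by apply: clos_sub; exact: Sexp.
have [k0 hk0] := hk _ p0E.
have lieA : lie S B0 by have := lieW k0 0; rewrite scale0r addr0.
have lieE p : p \in E -> lie S (@Bbasis R n p.1 p.2).
  move=> /hk [k <-]; have := lieB HS (lieW k 1) lieA.
  by rewrite scale1r addrC addKr.
have lie_contr i j : contr_rel E i j -> lie S (@Bbasis R n i j).
  move=> /andP[_ /orP[/lieE//|/lieE h]].
  exact: (lie_Bbasis_sym h).
have conn i j : connect (union_rel (fun i j => B0 i j != 0) (contr_rel E)) i j.
  apply: connect_sub (hc i j) => a b /orP[ab|ab]; apply: connect1; apply/orP.
    by left; exact: hB0.
  by right.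
have hall := lie_all HS lieA lie_contr h3 conn.
have dense := clos_full HS hall.
exists m, B0, Bs; split; last split => //; last split.
- by rewrite /m; case: (E) p0E.
(* Coefficients are indexed by matrices, and [Bs k] occurs once in the list without duplicates. *)
- move=> k; exists (fun g => (g == Bs k)%:R).
  rewrite (bigD1_seq (Bs k)) ?undup_uniq //=; last first.
    rewrite mem_undup; apply/mapP; exists (tnth (in_tuple E) k) => //.
    exact: mem_tnth.
  rewrite eqxx scale1r big1 ?addr0 // => g /negPf ->.
  by rewrite scale0r.
- move=> Y YSO; apply: reach_attainable => //.
  apply: (@dense_full R n S B0 p0.1 p0.2 n3 _ HS so0 _ dense Y YSO).
    by rewrite neq_ltn (ltE _ p0E).
  by move=> v t t0; rewrite -hk0; exact: Sexp.
Qed.
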